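(* Let $X=(X_t)_{t\ge 0}$ be a real-valued Markov chain, let $Z_t=f_0(X_t)+W_t$ for $t\ge 0$ with $f_0:\mathbb{R}\to\mathbb{R}$, and let $x_0\in\mathbb{R}$. Let $\mathcal{F}_n=\sigma(X_0,\dots,X_n)$. Assume: (1) $X$ is a Harris recurrent (irreducible, time-homogeneous) Markov chain whose kernel satisfies the minorization condition $P(x,A)\ge s(x)\nu(A)$ for all $x\in E$, $A\in\mathcal{E}$, where $s$ is measurable with $0\le s\le 1$, $\nu$ is a probability measure and $\int_E s\,d\nu>0$. (2) For each $n$, the variables $W_0,\dots,W_n$ are conditionally independent given $\mathcal{F}_n$, $\mathbb{E}(W_t\mid\mathcal{F}_n)=0$ and $\operatorname{Var}(W_t\mid\mathcal{F}_n)\le\sigma^2$ for some $\sigma>0$. (3) There is $\delta>0$ such that $C=[x_0-\delta,x_0+\delta]$ is a small set. (4) $x_0$ belongs to the interior of the support of the chain (the support of $\pi$). (5) With $F(y)=\pi(C\cap(-\infty,y])/\pi(C)$, $F$ is continuous and strictly increasing on $C$, in the sense that for all $x'\in C$ and $\epsilon>0$ there is $\gamma>0$ such that $|F^{-1}(u)-x'|>\gamma$ for all $u$ with $|u-F(x')|\ge\epsilon$. (6) $f_0$ is non-increasing, and for all $x'\in C$ and $\epsilon>0$ there is $\gamma>0$ such that $|f_0(x')-f_0(y)|>\gamma$ for all $y$ with $|y-x'|\ge\epsilon$. (7) $f_0$ is continuous on $C$. Let $\hat f_n$ be the localized non-increasing least squares estimator and $\hat f_n^{-1}$ its generalized inverse.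 Then, as $n\to\infty$, $$\hat f_n(x_0)=f_0(x_0)+o_P(1)\qquad\text{and}\qquad \hat f_n^{-1}(f_0(x_0))=x_0+o_P(1).$$
   Context: Chain. $E\subseteq\mathbb{R}$ is the state space with countably generated $\sigma$-algebra $\mathcal{E}$ (Borel sets), $P(x,A)$ the transition kernel, $\psi$ the maximal irreducibility measure. Harris recurrent means: for all $x\in E$ and all $A\in\mathcal{E}$ with $\psi(A)>0$, $\mathbb{P}(X_n\in A\text{ infinitely often}\mid X_0=x)=1$. Such a chain has a $\sigma$-finite invariant measure $\pi$ ($\pi(B)=\int P(x,B)\,d\pi(x)$), unique up to a multiplicative constant. A set $A\in\mathcal{E}$ with $\psi(A)>0$ is small if there are an integer $m_0\ge1$ and a nonzero positive measure $\nu'$ on $(E,\mathcal{E})$ with $P^{m_0}(x,B)\ge \mathbb{I}_A(x)\nu'(B)$ for all $x\in E$, $B\in\mathcal{E}$; a small set satisfies $0<\pi(A)<\infty$. In (5), $u$ ranges over the values where the inverse $F^{-1}$ of $F$ on $C$ is defined. Estimator. One observes $(X_t,Z_t)_{t=0}^n$. Let $T_n(C)=\sum_{t=0}^n\mathbb{I}\{X_t\in C\}$ (which tends to infinity a.s., so only $n$ with $T_n(C)\ge1$ matter). Let $Y_1<\dots<Y_m$ be the ordered distinct values among the $X_t$, $0\le t\le n$, lying in $C$. $\hat f_n$ is the minimizer of $f\mapsto\sum_{0\le t\le n,\,X_t\in C}(Z_t-f(X_t))^2$ over non-increasing functions $f:\mathbb{R}\to\mathbb{R}$; it is uniquely determined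 at $Y_1,\dots,Y_m$, and is taken to be constant on each $(Y_{k-1},Y_k]$, $k=2,\dots,m$, on $(-\infty,Y_1]$ and on $[Y_m,\infty)$. With an arbitrary random variable $Y_0<Y_1$, $\hat f_n^{-1}(a)$ is, for $a\in\mathbb{R}$, the greatest $y\in[Y_0,Y_m]$ with $\hat f_n(y)\ge a$, with the convention that it equals $Y_0$ if there is no such $y$. *)

(* Defs.v *)
From HB Require Import structures.
From mathcomp Require Import all_boot all_order all_algebra.
From mathcomp Require Import all_classical all_reals all_analysis.

Set Implicit Arguments.
Unset Strict Implicit.
Unset Printing Implicit Defensive.

Import Order.TTheory GRing.Theory Num.Theory.
Import numFieldNormedType.Exports.

Local Open Scope classical_set_scope.
Local Open Scope ring_scope.

(* [V] is a version of the conditional expectation of [Y] given the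
   sub-sigma-algebra [G]. *)
Definition is_cond_exp (R : realType) (d : measure_display)
    (Omega : measurableType d) (Pr : probability Omega R)
    (G : set (set Omega)) (Y V : Omega -> R) : Prop :=
  [/\ Pr.-integrable setT (fun w => (Y w)%:E),
      Pr.-integrable setT (fun w => (V w)%:E),
      (forall B : set R, measurable B -> G (V @^-1` B)) &
      forall A : set Omega, G A ->
        (\int[Pr]_(w in A) (V w)%:E = \int[Pr]_(w in A) (Y w)%:E)%E].

Definition is_cond_var (R : realType) (d : measure_display)
    (Omega : measurableType d) (Pr : probability Omega R)
    (G : set (set Omega)) (Y V : Omega -> R) : Prop :=
  exists2 M : Omega -> R, is_cond_exp Pr G Y M &
    is_cond_exp Pr G (fun w => (Y w - M w) ^+ 2) V.

(* Independence of subfamilies is the case where some [B i] are [setT]. *)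
Definition cond_independent (R : realType) (d : measure_display)
    (Omega : measurableType d) (Pr : probability Omega R)
    (G : set (set Omega)) (k : nat) (W : 'I_k -> Omega -> R) : Prop :=
  forall B : 'I_k -> set R, (forall i, measurable (B i)) ->
    exists V : 'I_k -> Omega -> R,
      (forall i, is_cond_exp Pr G \1_(W i @^-1` B i) (V i)) /\
      is_cond_exp Pr G \1_(\bigcap_(i in [set: 'I_k]) (W i @^-1` B i))
        (fun w => \prod_(i < k) V i w).

Definition natural_filtration (R : realType) (Omega : Type)
    (X : nat -> Omega -> R) (n : nat) : set (set Omega) :=
  g_sigma_preimage (fun i : 'I_n.+1 => X i).

(* The state space [E] is a Borel subset of the line and its sigma-algebra
   consists of the Borel subsets of [E].  A kernel on [E] is given by a kernel
   [P] on the line under which [E] is absorbing; [P x] is irrelevant for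
   [x] outside [E]. *)
Definition transition_kernel (R : realType) (E : set R) (P : R.-pker R ~> R)
    : Prop :=
  measurable E /\ forall x, E x -> P x E = 1%E.

Definition markov_chain (R : realType) (E : set R) (P : R.-pker R ~> R)
    (d : measure_display) (Omega : measurableType d)
    (Pr : probability Omega R) (X : nat -> {RV Pr >-> R}) : Prop :=
  (forall n w, E (X n w)) /\
  forall (n : nat) (A : set R), measurable A -> A `<=` E ->
    is_cond_exp Pr (natural_filtration X n)
      \1_(X n.+1 @^-1` A) (fun w => fine (P (X n w) A)).

Fixpoint kernel_iter (R : realType) (P : R.-pker R ~> R) (n : nat)
    (x : R) (A : set R) : \bar R :=
  if n is m.+1 then (\int[P x]_y kernel_iter P m y A)%E else \d_x A.

Definition irreducibility_measure (R : realType) (E : set R)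
    (P : R.-pker R ~> R) (phi : {measure set R -> \bar R}) : Prop :=
  [/\ sigma_finite [set: R] phi, phi (~` E) = 0%E, (0 < phi E)%E &
      forall A : set R, measurable A -> A `<=` E -> (0 < phi A)%E ->
        forall x, E x -> exists2 n, (0 < n)%N & (0 < kernel_iter P n x A)%E].

Definition maximal_irreducibility_measure (R : realType) (E : set R)
    (P : R.-pker R ~> R) (psi : {measure set R -> \bar R}) : Prop :=
  irreducibility_measure E P psi /\
  forall phi : {measure set R -> \bar R},
    irreducibility_measure E P phi -> phi `<< psi.

(* The law of the chain started from [x] is unique and exists for every [x]
   (Ionescu-Tulcea), so that P(X_n in A i.o. | X_0 = x) can be computed in
   any realization of that chain. *)
Definition harris_recurrent (R : realType) (E : set R) (P : R.-pker R ~> R)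
    (psi : {measure set R -> \bar R}) : Prop :=
  forall x, E x ->
    exists (d : measure_display) (Omega : measurableType d)
           (Q : probability Omega R) (X : nat -> {RV Q >-> R}),
      [/\ markov_chain E P X,
          Q (X 0%N @^-1` [set x]) = 1%E &
          forall A : set R, measurable A -> A `<=` E -> (0 < psi A)%E ->
            Q (lim_sup_set (fun n => X n @^-1` A)) = 1%E].

Definition minorization (R : realType) (E : set R) (P : R.-pker R ~> R)
    (s : R -> R) (nu : probability R R) : Prop :=
  [/\ measurable_fun E s, (forall x, E x -> 0 <= s x <= 1),
      nu E = 1%E, (0 < \int[nu]_(x in E) (s x)%:E)%E &
      forall x (A : set R), E x -> measurable A -> A `<=` E ->
        ((s x)%:E * nu A <= P x A)%E].

Definition small_set (R : realType) (E : set R) (P : R.-pker R ~> R)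
    (psi : {measure set R -> \bar R}) (A : set R) : Prop :=
  [/\ measurable A, A `<=` E, (0 < psi A)%E &
      exists (m0 : nat) (nu' : {measure set R -> \bar R}),
        [/\ (0 < m0)%N, (0 < nu' E)%E &
            forall x (B : set R), E x -> measurable B -> B `<=` E ->
              ((\1_A x)%:E * nu' B <= kernel_iter P m0 x B)%E]].

Definition invariant_measure (R : realType) (E : set R) (P : R.-pker R ~> R)
    (mu : {measure set R -> \bar R}) : Prop :=
  [/\ sigma_finite [set: R] mu, mu (~` E) = 0%E, (0 < mu E)%E &
      forall B : set R, measurable B -> B `<=` E ->
        mu B = (\int[mu]_(x in E) P x B)%E].

Definition measure_support (R : realType) (mu : {measure set R -> \bar R})
    : set R :=
  [set x | forall U : set R, open U -> U x -> (0 < mu U)%E].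

Definition localized_cdf (R : realType) (mu : {measure set R -> \bar R})
    (C : set R) (y : R) : R :=
  fine (mu (C `&` `]-oo, y])) / fine (mu C).

Definition num_visits (R : realType) (C : set R) (x : nat -> R) (n : nat)
    : nat :=
  (\sum_(0 <= t < n.+1) (x t \in C))%N.

(* Y_1 < ... < Y_m, indexed from 0. *)
Definition ordered_points (R : realType) (C : set R) (x : nat -> R) (n : nat)
    : seq R :=
  sort <=%R (undup [seq x t | t <- iota 0 n.+1 & x t \in C]).

Definition residual_sum (R : realType) (C : set R) (x z : nat -> R) (n : nat)
    (f : R -> R) : R :=
  \sum_(0 <= t < n.+1 | x t \in C) (z t - f (x t)) ^+ 2.

(* When [num_visits C x n] is zero, [residual_sum] vanishes and every
   non-increasing constant function qualifies. *)
Definition localized_isotonic_lse (R : realType) (C : set R)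
    (x z : nat -> R) (n : nat) (g : R -> R) : Prop :=
  let Y := ordered_points C x n in
  [/\ nonincreasing_fun g,
      (forall f : R -> R, nonincreasing_fun f ->
        residual_sum C x z n g <= residual_sum C x z n f),
      (forall y, y <= Y`_0 -> g y = g Y`_0),
      (forall k y, (k.+1 < size Y)%N -> Y`_k < y <= Y`_k.+1 ->
        g y = g Y`_k.+1) &
      (forall y, last 0 Y <= y -> g y = g (last 0 Y))].

(* [xget lo S] is [lo] when [S] is empty. *)
Definition generalized_inverse (R : realType) (g : R -> R) (lo hi a : R) : R :=
  let S := [set y | lo <= y <= hi /\ a <= g y] in
  xget lo (S `&` ubound S).

(* The outer measure [mu_ext Pr] agrees with [Pr] on measurable sets; it makes
   the notion meaningful without measurability of [U n]. *)
Definition is_oP1 (R : realType) (d : measure_display)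
    (Omega : measurableType d) (Pr : probability Omega R)
    (U : nat -> Omega -> R) : Prop :=
  forall eps : R, 0 < eps ->
    mu_ext Pr [set w | eps < `|U n w|] @[n --> \oo] --> 0%E.

(* Main.v *)
Require Import Defs.
From HB Require Import structures.
From mathcomp Require Import all_boot all_order all_algebra.
From mathcomp Require Import all_classical all_reals all_analysis.
From mathcomp Require Import measurable_realfun.
From mathcomp Require Import ring lra zify.

Set Implicit Arguments.
Unset Strict Implicit.
Unset Printing Implicit Defensive.

Import Order.TTheory GRing.Theory Num.Theory.
Import numFieldNormedType.Exports.

Local Open Scope classical_set_scope.
Local Open Scope ring_scope.

(** Why the theorem holds.

    The noise.  Given the positions of the chain, the noise variables are
    orthogonal with second moments bounded by [sigma ^+ 2]
    ([cond_independent_orthogonal], [cond_var_bound]).  For orthogonal variables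
    the partial sums at the squares [j ^ 2] are controlled by Chebyshev's
    inequality and those between two squares by the Cauchy-Schwarz inequality, as
    in the simplest proof of a strong law of large numbers.  Hence, with high
    probability, all blocks of consecutive sites that start at a fixed end and
    contain at least [m ^ 2] sites have a small mean noise, with a bound that
    depends on [m] but not on the sample size ([maximal_inequality]).  The order of
    the sites on the line is random, but it is known from the positions and takes
    finitely many values.

    The fit.  Suppose that the fit exceeds [f0 x1 + eps] at [x1].  Choose [u < x1]
    with [f0 u] close to [f0 x1].  Lowering the fit slightly on the sites to the
    right of [u] where it is at least its value at [x1] keeps it non-increasing, so
    by optimality the residuals have a non-negative sum over that block
    ([lse_level_set_sum]).  There the fit exceeds [f0] by a fixed amount, so the
    mean noise over the block is large, although the block contains every visit to
    [[u, x1]] ([lse_overshoot]).  This has small probability as soon as the number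
    of visits to [[u, x1]] tends to infinity, since the bound on the noise is
    uniform over all blocks with many sites, whatever fraction of the visits to [C]
    they represent.  Undershooting is symmetric.

    The visits.  A set with positive [psi] measure is visited infinitely often by the
    given chain, because the probabilities of avoiding it for [k] steps depend on
    the kernel and the starting point alone, and tend to [0] in the realizations
    provided by Harris recurrence ([num_visits_cvg_infty]).  Strict monotonicity of
    [F] gives positive [mu] measure to all intervals inside [C].  To pass from [mu]
    to [psi], the invariant measure is shown to be itself an irreducibility measure
    ([invariant_irreducible]), so that maximality of [psi] gives [mu `<< psi].

    The inverse.  By strict monotonicity of [f0], consistency of the fit at
    [x0 - e] and [x0 + e] places the level [f0 x0] strictly between the values of
    the fit at these points, so the generalized inverse at [f0 x0] lies between
    them ([generalized_inverse_ge]). *)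

(** * Functionals that behave like integrals *)

Section integral_like.
Local Open Scope ereal_scope.
Context d (T : measurableType d) (R : realType).
Implicit Types (L : (T -> \bar R) -> \bar R) (f g : T -> \bar R).
Import HBNNSimple.

Definition nnmeas (f : T -> \bar R) :=
  measurable_fun [set: T] f /\ forall x, 0 <= f x.

(** The properties by which the value of an integral on indicators determines
    its value on all non-negative measurable functions.  Isolating them lets
    iterated integrals and weighted integrals be identified without turning
    each of them into a measure. *)
Definition integral_like L :=
  [/\ (forall f g, nnmeas f -> nnmeas g ->
         L (fun x => f x + g x) = L f + L g),
      (forall (k : R) f, (0 <= k)%R -> nnmeas f ->
         L (fun x => k%:E * f x) = k%:E * L f),
      (forall f g, nnmeas f -> nnmeas g -> (forall x, f x <= g x) ->
         L f <= L g) &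
      (forall (u : nat -> T -> \bar R) f, (forall n, nnmeas (u n)) ->
         (forall x m n, (m <= n)%N -> u m x <= u n x) ->
         nnmeas f -> (forall x, u n x @[n --> \oo] --> f x) ->
         L (u n) @[n --> \oo] --> L f)].

Lemma nnmeas_indic (B : set T) : measurable B ->
  nnmeas (fun x => (\1_B x : R)%:E).
Proof.
move=> mB; split; first exact/measurable_EFinP/measurable_indic.
by move=> x; rewrite lee_fin.
Qed.

Lemma integral_like_ge0 L f : integral_like L -> nnmeas f -> 0 <= L f.
Proof.
move=> [_ LZ Lle _] nf.
have nn0 : nnmeas (cst (0 : \bar R)) by split; first exact: measurable_cst.
have <- : L (cst 0) = 0.
  rewrite (_ : cst 0 = fun x => (0 : R)%:E * cst (0 : \bar R) x).
    by rewrite LZ// mul0e.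
  by apply/funext => x; rewrite mul0e.
apply: (Lle _ _ nn0 nf) => x; exact: nf.2.
Qed.

Lemma integral_like_ext L L' : integral_like L -> integral_like L' ->
  (forall B, measurable B ->
     L (fun x => (\1_B x)%:E) = L' (fun x => (\1_B x)%:E)) ->
  forall f, nnmeas f -> L f = L' f.
Proof.
move=> [LD LZ _ Lcvg] [L'D L'Z _ L'cvg] LL' f [mf f0].
have ind_seq (h : {nnsfun T >-> R}) (s : seq R) : (forall r, r \in s -> (0 <= r)%R) ->
    nnmeas (fun x => (\sum_(r <- s) r * \1_(h @^-1` [set r]) x)%:E) /\
    L (fun x => (\sum_(r <- s) r * \1_(h @^-1` [set r]) x)%:E) =
    L' (fun x => (\sum_(r <- s) r * \1_(h @^-1` [set r]) x)%:E).
  elim: s => [|r s IHs] s0.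
    have nn0 : nnmeas (cst (0 : \bar R)).
      by split; first exact: measurable_cst.
    rewrite (_ : (fun x => _) = (cst 0)); last first.
      by apply/funext => x; rewrite big_nil.
    split => //.
    have -> : cst 0 = (fun x : T => (0%R : R)%:E * cst 0 x).
      by apply/funext => x; rewrite mul0e.
    by rewrite LZ// L'Z// !mul0e.
  have [|nns IH] := IHs; first by move=> t ts; apply: s0; rewrite inE ts orbT.
  have r0 : (0 <= r)%R by apply: s0; rewrite inE eqxx.
  have ni := @nnmeas_indic (h @^-1` [set r]) (measurable_funPTI h (measurable_set1 r)).
  have nr : nnmeas (fun x => r%:E * (\1_(h @^-1` [set r]) x)%:E).
    case: ni => mi i0; split; first exact: measurable_funeM.
    by move=> x; rewrite mule_ge0.
  rewrite (_ : (fun x => _) = fun x => r%:E * (\1_(h @^-1` [set r]) x)%:E +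
    (\sum_(r <- s) r * \1_(h @^-1` [set r]) x)%:E); last first.
    by apply/funext => x; rewrite big_cons EFinD EFinM.
  split.
    case: nr nns => [mr r0'] [ms s0']; split; first exact: emeasurable_funD.
    by move=> x; rewrite adde_ge0.
  rewrite LD// L'D// IH; congr (_ + _).
  by rewrite LZ// L'Z// LL'//; apply: measurable_funPTI.
pose g_ n := nnsfun_approx measurableT mf n.
have LL'g n : nnmeas (EFin \o g_ n) /\ L (EFin \o g_ n) = L' (EFin \o g_ n).
  set s : seq R := finmap.enum_fset (fset_set (range (g_ n))).
  have -> : EFin \o g_ n =
      (fun x => (\sum_(r <- s) r * \1_(g_ n @^-1` [set r]) x)%:E).
    by apply/funext => x /=; rewrite {1}(fimfunE (g_ n) x) fsbig_finite.
  apply: ind_seq => r; rewrite /s in_fset_set// inE => -[x _ <-].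
  exact: fun_ge0.
have gf x : (EFin \o g_ n) x @[n --> \oo] --> f x.
  exact: cvg_nnsfun_approx.
have gnd x m n : (m <= n)%N -> (EFin \o g_ m) x <= (EFin \o g_ n) x.
  by move=> mn; rewrite /= lee_fin; exact/lefP/nd_nnsfun_approx.
have h1 := Lcvg (fun n => EFin \o g_ n) f (fun n => (LL'g n).1) gnd (conj mf f0) gf.
have h2 := L'cvg (fun n => EFin \o g_ n) f (fun n => (LL'g n).1) gnd (conj mf f0) gf.
have h3 : (fun n => L (EFin \o g_ n)) = (fun n => L' (EFin \o g_ n)).
  by apply/funext => n; exact: (LL'g n).2.
have h4 : (fun n => L (EFin \o g_ n)) @ \oo --> L f := h1.
by rewrite h3 in h4; exact: (cvg_unique (@ereal_hausdorff _) h4 h2).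
Qed.

End integral_like.

Section integral_like_instances.
Local Open Scope ereal_scope.
Context (R : realType).

Lemma integral_like_mixture d (S : measurableType d) (m : {measure set S -> \bar R})
    (D : set S) d' (T : measurableType d') (L : S -> (T -> \bar R) -> \bar R) :
  measurable D -> (forall s, D s -> integral_like (L s)) ->
  (forall f, nnmeas f -> measurable_fun D (L^~ f)) ->
  integral_like (fun f => \int[m]_(s in D) L s f).
Proof.
move=> mD iL mL.
have L0 s f : D s -> nnmeas f -> 0 <= L s f.
  by move=> Ds; apply: integral_like_ge0; exact: iL.
split.
- move=> f g nf ng.
  rewrite (eq_integral (fun s => L s f + L s g)); last first.
    by move=> s /[!inE] Ds; have [->] := iL s Ds.
  by rewrite ge0_integralD//; [move=> s Ds; exact: L0|exact: mL
    |move=> s Ds; exact: L0|exact: mL].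
- move=> k f k0 nf.
  rewrite (eq_integral (fun s => k%:E * L s f)); last first.
    by move=> s /[!inE] Ds; have [_ ->] := iL s Ds.
  by rewrite ge0_integralZl//; [exact: mL|move=> s Ds; exact: L0].
- move=> f g nf ng fg; apply: ge0_le_integral => //.
  + by move=> s Ds; exact: L0.
  + exact: mL.
  + exact: mL.
  + by move=> s Ds; have [_ _ + _] := iL s Ds; apply.
- move=> u f nu ndu nf uf.
  have Lcv s : D s -> L s (u n) @[n --> \oo] --> L s f.
    by move=> Ds; have [_ _ _] := iL s Ds; apply.
  have <- : \int[m]_(s in D) limn (fun n => L s (u n)) = \int[m]_(s in D) L s f.
    by apply: eq_integral => s /[!inE] Ds; apply/cvg_lim => //; exact: Lcv.
  apply: cvg_monotone_convergence => //.
  + by move=> n; exact: mL.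
  + by move=> n s Ds; exact: L0.
  + move=> s Ds a b ab; have [_ _ + _] := iL s Ds; apply => //.
    by move=> x; exact: ndu.
Qed.

Lemma integral_like_eval d (T : measurableType d) (t : T) (c : R) :
  (0 <= c)%R -> integral_like (fun f : T -> \bar R => f t * c%:E).
Proof.
move=> c0; split.
- by move=> f g [_ f0] [_ g0]; rewrite ge0_muleDl.
- by move=> k f k0 nf; rewrite muleA.
- by move=> f g _ _ fg; rewrite lee_wpmul2r// lee_fin.
- by move=> u f nu ndu nf uf; apply: cvgeZr => //; exact: uf.
Qed.

Lemma integral_like_comp d (S : measurableType d) (m : {measure set S -> \bar R})
    (D : set S) d' (T : measurableType d') (h : S -> T) :
  measurable D -> measurable_fun D h ->
  integral_like (fun f => \int[m]_(s in D) f (h s)).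
Proof.
move=> mD mh.
have := @integral_like_mixture _ _ m D _ T (fun s f => f (h s) * (1%R)%:E).
rewrite (_ : (fun f => _) = (fun f => \int[m]_(s in D) f (h s))); last first.
  by apply/funext => f; under eq_integral do rewrite mule1.
apply => //; first by move=> x _; exact: integral_like_eval.
by move=> f [mf _]; under eq_fun do rewrite mule1; exact: measurableT_comp.
Qed.

Lemma integral_like_integral d (T : measurableType d)
    (m : {measure set T -> \bar R}) :
  integral_like (fun f => \int[m]_x f x).
Proof. exact: (@integral_like_comp _ _ m setT _ T id). Qed.

Lemma integral_like_kernel d (S : measurableType d) (m : {measure set S -> \bar R})
    (D : set S) d' (T : measurableType d') d'' (U : measurableType d'')
    (k : R.-ker T ~> U) (h : S -> T) :
  measurable D -> measurable_fun D h ->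
  integral_like (fun f => \int[m]_(s in D) \int[k (h s)]_u f u).
Proof.
move=> mD mh; apply: integral_like_mixture => //.
  by move=> s Ds; exact: integral_like_integral.
move=> g [mg g0].
apply: (@measurableT_comp _ _ _ _ _ _ (fun t => \int[k t]_u g u)) => //.
apply: (measurable_fun_integral_kernel (l := k)) => //.
by move=> V mV; exact: measurable_kernel.
Qed.

(** The positive and the negative part of [U], used as densities, give the same
    mass to every event [T @^-1` B], hence the same integral to every function
    of [T]. *)
Lemma integral_mul_eq0 d (S : measurableType d) (m : {measure set S -> \bar R})
    (U T : S -> R) :
  m.-integrable setT (EFin \o U) -> measurable_fun setT T ->
  m.-integrable setT (fun s => (U s * T s)%:E) ->
  (forall B : set R, measurable B -> \int[m]_(s in T @^-1` B) (U s)%:E = 0) ->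
  \int[m]_s (U s * T s)%:E = 0.
Proof.
move=> iU mT iUT U0.
have mU : measurable_fun setT U by apply/measurable_EFinP; exact: measurable_int iU.
have mTB B : measurable B -> measurable (T @^-1` B).
  by move=> mB; rewrite -[X in measurable X]setTI; exact: mT.
have iw (V : S -> R) : measurable_fun setT V -> (forall s, (0 <= V s)%R) ->
    integral_like (fun f : R -> \bar R => \int[m]_s (f (T s) * (V s)%:E)).
  move=> mV V0.
  apply: (@integral_like_mixture _ _ m setT _ R (fun s f => f (T s) * (V s)%:E)) => //.
    by move=> s _; exact: integral_like_eval.
  move=> f [mf f0]; apply: emeasurable_funM; last exact/measurable_EFinP.
  exact: measurableT_comp.
have key (f : R -> \bar R) : nnmeas f ->
    \int[m]_s (f (T s) * (U^\+ s)%:E)%E = \int[m]_s (f (T s) * (U^\- s)%:E)%E.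
  apply: (integral_like_ext (iw _ _ _) (iw _ _ _)).
  - exact: measurable_funrpos.
  - by move=> s; exact: funrpos_ge0.
  - exact: measurable_funrneg.
  - by move=> s; exact: funrneg_ge0.
  - move=> B mB.
    have iB (V : S -> R) : \int[m]_s ((\1_B (T s))%:E * (V s)%:E) =
        \int[m]_(s in T @^-1` B) (V s)%:E.
      rewrite [RHS]integral_mkcond; apply: eq_integral => s _.
      rewrite /patch indicE (_ : (s \in T @^-1` B) = (T s \in B)).
        by case: ifPn => _; rewrite ?mul1e ?mul0e.
      by apply/idP/idP; rewrite !inE.
    rewrite !iB.
    have iTB : m.-integrable (T @^-1` B) (EFin \o U).
      by apply: integrableS iU => //; exact: mTB.
    have := U0 B mB; rewrite integralE.
    rewrite (_ : (fun s => (U s)%:E)^\+ = EFin \o U^\+%R); last exact/funerpos.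
    rewrite (_ : (fun s => (U s)%:E)^\- = EFin \o U^\-%R); last exact/funerneg.
    move=> /eqP; rewrite sube_eq ?add0e; first by move=> /eqP.
      apply: integrable_fin_num; first exact: mTB.
      by apply: integrable_funrpos => //; exact: mTB.
    rewrite fin_num_adde_defr//.

have iM (V Y : S -> R) : measurable_fun setT V -> measurable_fun setT Y ->
    (forall s, (`|V s| <= `|U s|)%R) -> (forall s, (`|Y s| <= `|T s|)%R) ->
    m.-integrable setT (EFin \o (fun s => (Y s * V s)%R)).
  move=> mV mY VU YT; apply: le_integrable iUT => //.
    by apply/measurable_EFinP; exact: measurable_funM.
  by move=> s _; rewrite /= lee_fin !normrM mulrC ler_pM.
have nrp (V : S -> R) s : (`|V^\+ s| <= `|V s|)%R.
  by rewrite ger0_norm// /funrpos ge_max ler_norm normr_ge0.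
have nrn (V : S -> R) s : (`|V^\- s| <= `|V s|)%R.
  by rewrite ger0_norm// /funrneg ge_max -normrN ler_norm normr_ge0.
have mUp := measurable_funrpos mU; have mUn := measurable_funrneg mU.
have mTp := measurable_funrpos mT; have mTn := measurable_funrneg mT.
have ipp := iM _ _ mUp mTp (nrp U) (nrp T).
have ipn := iM _ _ mUp mTn (nrp U) (nrn T).
have inp := iM _ _ mUn mTp (nrn U) (nrp T).
have inn := iM _ _ mUn mTn (nrn U) (nrn T).
have kp : \int[m]_s (T^\+ s * U^\+ s)%:E = \int[m]_s (T^\+ s * U^\- s)%:E.
  apply: (key (fun y => (Num.max y 0)%:E)); split; last first.
    by move=> y; rewrite lee_fin le_max lexx orbT.
  by apply/measurable_EFinP; exact: measurable_maxr.
have kn : \int[m]_s (T^\- s * U^\+ s)%:E = \int[m]_s (T^\- s * U^\- s)%:E.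
  apply: (key (fun y => (Num.max (- y) 0)%:E)); split; last first.
    by move=> y; rewrite lee_fin le_max lexx orbT.
  apply/measurable_EFinP; apply: measurable_maxr => //; exact: oppr_measurable.
rewrite (eq_integral (fun s => (((T^\+ s * U^\+ s) + (T^\- s * U^\- s))%:E -
    ((T^\+ s * U^\- s) + (T^\- s * U^\+ s))%:E))); last first.
  move=> s _; rewrite -EFinB; congr EFin.
  have -> : U s = (U^\+ s - U^\- s)%R.
    by rewrite -[LHS](congr1 (fun f => f s) (funrposBneg U)).
  have -> : T s = (T^\+ s - T^\- s)%R.
    by rewrite -[LHS](congr1 (fun f => f s) (funrposBneg T)).
  ring.
rewrite integralB_EFin//; [|exact: integrableD ipp inn|exact: integrableD inp ipn].
rewrite (integralD_EFin measurableT ipp inn) (integralD_EFin measurableT inp ipn).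
rewrite kp kn subee// fin_numD; apply/andP; split.
  exact: (integrable_fin_num measurableT inp).
exact: (integrable_fin_num measurableT inn).
Qed.

End integral_like_instances.

(** * Conditional expectations and orthogonality of the noise *)

Section conditional_expectation.
Context d (Omega : measurableType d) (R : realType) (Pr : probability Omega R).
Implicit Types (G : set (set Omega)) (Y V H : Omega -> R).

Lemma sigma_algebra_preimage_fun G (V : Omega -> R) : sigma_algebra setT G ->
  (forall B : set R, measurable B -> G (V @^-1` B)) ->
  measurable_fun setT (V : g_sigma_algebraType G -> R).
Proof.
move=> sG GV _ B mB; rewrite setTI.
rewrite -[X in X _](_ : G = @measurable _ (g_sigma_algebraType G)); first exact: GV.
by rewrite measurable_g_measurableTypeE.
Qed.

Lemma sigma_algebra_lt G (V V' : Omega -> R) : sigma_algebra setT G ->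
  (forall B : set R, measurable B -> G (V @^-1` B)) ->
  (forall B : set R, measurable B -> G (V' @^-1` B)) ->
  G [set w | V w < V' w].
Proof.
move=> sG GV GV'.
rewrite (_ : G = @measurable _ (g_sigma_algebraType G)); last first.
  by rewrite measurable_g_measurableTypeE.
have := measurable_fun_ltr (sigma_algebra_preimage_fun sG GV)
  (sigma_algebra_preimage_fun sG GV').
move=> /(_ measurableT [set true]) /(_ I); rewrite setTI.
by congr (measurable _); apply/seteqP; split.
Qed.


Context (G : set (set Omega)) (sG : sigma_algebra setT G)
  (Gm : G `<=` measurable).

Lemma sub_measurable_fun (V : Omega -> R) :
  (forall B : set R, measurable B -> G (V @^-1` B)) -> measurable_fun setT V.
Proof. by move=> GV _ B mB; rewrite setTI; apply: Gm; exact: GV. Qed.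

(** The event on which the two versions are in the wrong order belongs to [G], so
    the defining property of both versions applies to it. *)
Lemma cond_exp_le Y V Y' V' : is_cond_exp Pr G Y V -> is_cond_exp Pr G Y' V' ->
  (forall w, Y w <= Y' w) -> {ae Pr, forall w, V w <= V' w}.
Proof.
move=> [iY iV GV VE] [iY' iV' GV' V'E] YY'.
pose A := [set w | V' w < V w].
have GA : G A by exact: sigma_algebra_lt.
have mA : measurable A by exact: Gm.
have iS (f : Omega -> R) :
    Pr.-integrable setT (EFin \o f) -> Pr.-integrable A (EFin \o f).
  by move=> i; exact: integrableS i.
exists A; split => //; last by move=> w /= /negP; rewrite -ltNge.
have mVV : measurable_fun A (fun w => (V w - V' w)%:E).
  apply/measurable_EFinP; apply: measurable_funB.
    by apply/measurable_EFinP; exact: measurable_int (iS _ iV).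
  by apply/measurable_EFinP; exact: measurable_int (iS _ iV').
have I0 : (\int[Pr]_(w in A) `|(V w - V' w)%:E| = 0)%E.
  rewrite (eq_integral (fun w => ((V w)%:E - (V' w)%:E)%E)); last first.
    by move=> w /[!inE] Aw; rewrite -EFinB gee0_abs// lee_fin subr_ge0 ltW.
  apply/eqP; rewrite eq_le; apply/andP; split; last first.
    by apply: integral_ge0 => w Aw; rewrite -EFinB lee_fin subr_ge0 ltW.
  rewrite integralB_EFin//; [|exact: iS|exact: iS].
  rewrite VE// V'E// sube_le0; apply: le_integral => //; [exact: iS|exact: iS|].
  by move=> w _; rewrite lee_fin.
have /(ae_eq_integral_abs _ mA mVV) [N [mN N0 AN]] := I0.
apply: (subset_measure0 mA mN _ N0) => w Aw; apply: AN => /= /(_ Aw) /eqP.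
by rewrite eqe subr_eq0 => /eqP E; move: Aw; rewrite /A /= E ltxx.
Qed.

Lemma cond_exp_uniq Y V V' : is_cond_exp Pr G Y V -> is_cond_exp Pr G Y V' ->
  {ae Pr, forall w, V w = V' w}.
Proof.
move=> h h'; have := cond_exp_le h h' (fun=> lexx _).
have := cond_exp_le h' h (fun=> lexx _).
by apply: filterS2 => w /= h1 h2; apply/le_anti; rewrite h1 h2.
Qed.

Lemma cond_exp_cst (c : R) : is_cond_exp Pr G (fun=> c) (fun=> c).
Proof.
have ic : Pr.-integrable setT (fun=> c%:E).
  by apply: finite_measure_integrable_cst.
split => // B mB; have [G0 GD GU] := sG.
have [Bc|Bc] := pselect (B c).
  rewrite (_ : _ @^-1` _ = setT `\` set0); first exact: GD.
  by rewrite setD0; apply/seteqP; split.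
by rewrite (_ : _ @^-1` _ = set0)//; apply/seteqP; split.
Qed.

Lemma sigma_algebra_setT : G setT.
Proof. by have [G0 GD _] := sG; rewrite -[setT]setD0; exact: GD. Qed.

Lemma sigma_algebra_setI A B : G A -> G B -> G (A `&` B).
Proof.
rewrite (_ : G = @measurable _ (g_sigma_algebraType G)); last first.
  by rewrite measurable_g_measurableTypeE.
exact: measurableI.
Qed.

Lemma integral_indicM (D : set Omega) (f : Omega -> R) :
  (\int[Pr]_(w in D) (f w)%:E = \int[Pr]_w (\1_D w * f w)%:E)%E.
Proof.
rewrite integral_mkcond; apply: eq_integral => w _.
by rewrite /patch indicE; case: ifPn => _; rewrite ?mul1r ?mul0r.
Qed.

Lemma integrable_indicM (D : set Omega) (f : Omega -> R) : measurable D ->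
  Pr.-integrable setT (EFin \o f) ->
  Pr.-integrable setT (EFin \o (fun w => \1_D w * f w)).
Proof.
move=> mD iF; have mf : measurable_fun setT f.
  by apply/measurable_EFinP; exact: measurable_int iF.
apply: le_integrable iF => //.
  by apply/measurable_EFinP; apply: measurable_funM => //; exact: measurable_indic.
move=> w _; rewrite /= lee_fin normrM indicE.
by case: (w \in D); rewrite ?normr1 ?normr0 ?mul1r ?mul0r.
Qed.

Lemma indicIM (A B : set Omega) w :
  \1_A w * \1_B w = \1_(A `&` B) w :> R.
Proof. by rewrite indicI. Qed.

Lemma integral_indicB (D : set Omega) (f g : Omega -> R) : measurable D ->
  Pr.-integrable setT (EFin \o f) -> Pr.-integrable setT (EFin \o g) ->
  (\int[Pr]_(w in D) (f w)%:E = \int[Pr]_(w in D) (g w)%:E)%E <->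
  (\int[Pr]_w (\1_D w * (f w - g w))%:E = 0)%E.
Proof.
move=> mD iF iG.
have iFD : Pr.-integrable D (EFin \o f) by exact: integrableS iF.
have iGD : Pr.-integrable D (EFin \o g) by exact: integrableS iG.
rewrite -integral_indicM; under [in X in _ <-> X]eq_integral do rewrite EFinB.
rewrite integralB_EFin//; split => [->|/eqP].
  by rewrite subee//; exact: integrable_fin_num iGD.
rewrite sube_eq ?add0e => [/eqP//||]; first exact: integrable_fin_num iFD.
by rewrite fin_num_adde_defr.
Qed.

(** The factor [H] is replaced by indicators of its level events, which belong to
    [G]. *)
Lemma cond_exp_pull_out Y V H D : is_cond_exp Pr G Y V ->
  (forall B : set R, measurable B -> G (H @^-1` B)) ->
  Pr.-integrable setT (EFin \o (fun w => Y w * H w)) ->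
  Pr.-integrable setT (EFin \o (fun w => V w * H w)) -> G D ->
  (\int[Pr]_(w in D) (Y w * H w)%:E = \int[Pr]_(w in D) (V w * H w)%:E)%E.
Proof.
move=> [iY iV GV VE] GH iYH iVH GD.
have mD : measurable D by exact: Gm.
apply/(integral_indicB mD iYH iVH).
have iYV : Pr.-integrable setT (EFin \o (fun w => Y w - V w)).
  exact: (integrableB measurableT iY iV).
under eq_integral do rewrite -mulrBl mulrA.
apply: integral_mul_eq0.
- exact: integrable_indicM.
- exact: sub_measurable_fun.
- under eq_fun do rewrite -mulrA mulrBl.
  by apply: integrable_indicM => //; exact: (integrableB measurableT iYH iVH).
- move=> B mB.
  have GA : G (H @^-1` B `&` D) by apply: sigma_algebra_setI => //; exact: GH.
  rewrite integral_indicM; under eq_integral do rewrite mulrA indicIM.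
  by apply/(integral_indicB (Gm GA) iY iV); rewrite VE.
Qed.

Lemma integrable_ae_eq (V V' : Omega -> R) : measurable_fun setT V' ->
  {ae Pr, forall w, V w = V' w} -> Pr.-integrable setT (EFin \o V) ->
  Pr.-integrable setT (EFin \o V').
Proof.
move=> mV' VV' /integrableP[mV iV]; apply/integrableP; split.
  exact/measurable_EFinP.
rewrite (_ : integral _ _ _ = \int[Pr]_w `|(V w)%:E|)%E//.
apply: ae_eq_integral => //.
- by apply: measurableT_comp => //; exact/measurable_EFinP.
- exact: measurableT_comp.
- by apply: filterS VV' => w /= -> _.
Qed.

Lemma cond_exp_ae_eq Y V V' : is_cond_exp Pr G Y V ->
  (forall B : set R, measurable B -> G (V' @^-1` B)) ->
  {ae Pr, forall w, V w = V' w} -> is_cond_exp Pr G Y V'.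
Proof.
move=> [iY iV GV VE] GV' VV'; have mV' := sub_measurable_fun GV'.
split => //; first exact: integrable_ae_eq VV' iV.
move=> A GA; rewrite -VE//; apply/esym; apply: ae_eq_integral => //.
- exact: Gm.
- apply: measurable_funTS; exact: measurable_int iV.
- by apply: measurable_funTS; exact/measurable_EFinP.
- by apply: filterS VV' => w /= -> _.
Qed.

(* Versions of conditional probabilities are only almost everywhere in
   [[0, 1]]; clipping them makes all products below integrable. *)
Let clip (y : R) := Num.min (Num.max y 0) 1.

Let clip_bound y : 0 <= clip y <= 1.
Proof. by rewrite /clip le_min ler01 le_max lexx orbT/= ge_min lexx orbT. Qed.

Let clipE y : 0 <= y <= 1 -> clip y = y.
Proof. by move=> /andP[y0 y1]; rewrite /clip max_l// min_l. Qed.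

Let cond_exp_indic (A : set Omega) V : is_cond_exp Pr G \1_A V ->
  {ae Pr, forall w, V w = clip (V w)} /\ is_cond_exp Pr G \1_A (clip \o V).
Proof.
move=> VA; have h0 := cond_exp_le (cond_exp_cst 0) VA.
have h1 := cond_exp_le VA (cond_exp_cst 1).
have ae : {ae Pr, forall w, V w = clip (V w)}.
  apply: (filterS2 _ _ (h0 _) (h1 _)) => [w /= v0 v1|w|w].
  - by rewrite clipE// v0 v1.
  - by rewrite indicE.
  - by rewrite indicE; case: (_ \in _).
split => //; apply: (cond_exp_ae_eq VA _ ae) => B mB.
have mclip : measurable_fun setT clip.
  by apply: measurable_minr => //; apply: measurable_maxr.
have [_ _ GV _] := VA; rewrite comp_preimage; apply: (GV (clip @^-1` B)).
by rewrite -[X in measurable X]setTI; exact: mclip.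
Qed.

Let integrable_bounded2 (U H : Omega -> R) : measurable_fun setT H ->
  (forall w, `|H w| <= 1) -> Pr.-integrable setT (EFin \o U) ->
  Pr.-integrable setT (EFin \o (fun w => U w * H w)).
Proof.
move=> mH H1 iU; apply: le_integrable (iU) => //.
  apply/measurable_EFinP; apply: measurable_funM => //.
  by apply/measurable_EFinP; exact: measurable_int iU.
by move=> w _; rewrite /= lee_fin normrM ler_piMr.
Qed.

(** The product rule for events is passed to the variables by freezing one factor
    at a time.  First [W j] stays inside an indicator, whose conditional
    probability [Vs] is fixed once and for all, while [W i] replaces its own
    indicator; since [W i] is centred, pulling [Vs] out leaves [0].  Then [W j]
    replaces its indicator. *)
Lemma cond_independent_orthogonal k (W : 'I_k -> Omega -> R) i j D :
  cond_independent Pr G W -> (forall t, measurable_fun setT (W t)) -> i != j ->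
  is_cond_exp Pr G (W i) (fun=> 0) ->
  Pr.-integrable setT (EFin \o (fun w => W i w * W j w)) -> G D ->
  (\int[Pr]_(w in D) (W i w * W j w)%:E = 0)%E.
Proof.
move=> ci mW ij EWi iWW GD; have mD := Gm GD.
have [iWi i0 _ _] := EWi.
have mpre t (B : set R) : measurable B -> measurable (W t @^-1` B).
  by move=> mB; rewrite -[X in measurable X]setTI; exact: mW.
have WiB (B : set R) : measurable B ->
    (\int[Pr]_(w in D) (W i w * \1_B (W j w))%:E = 0)%E.
  move=> mB.
  pose fam (A : set R) t := if t == i then A else if t == j then B else setT.
  have mfam A : measurable A -> forall t, measurable (fam A t).
    by move=> mA t; rewrite /fam; case: ifP => // _; case: ifP.
  have bigcapE A : \bigcap_(t in [set: 'I_k]) (W t @^-1` fam A t) =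
      W i @^-1` A `&` W j @^-1` B.
    apply/seteqP; split => [w h|w [hi hj] t _].
      split; first by have := h i I; rewrite /= /fam eqxx.
      by have := h j I; rewrite /= /fam eq_sym (negbTE ij) eqxx.
    by rewrite /= /fam; case: eqP => [->//|_]; case: eqP => [->//|_].
  have [V0 [V0E _]] := ci _ (mfam setT measurableT).
  have famj A : fam A j = B by rewrite /fam eq_sym (negbTE ij) eqxx.
  have [_ Vj] := cond_exp_indic (V0E j); rewrite famj in Vj.
  pose Vs := clip \o V0 j.
  have [iBj iVs GVs _] := Vj.
  have mVs := sub_measurable_fun GVs.
  have Vs1 w : `|Vs w| <= 1.
    by have /andP[a b] := clip_bound (V0 j w); rewrite ger0_norm.
  have mBj : measurable_fun setT (\1_(W j @^-1` B) : Omega -> R).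
    by apply: measurable_indic; exact: mpre.
  have ind1 (A : set Omega) w : `|(\1_A : Omega -> R) w| <= 1.
    by rewrite indicE; case: (_ \in _); rewrite ?normr1// normr0.
  have ind1' (A : set R) (x : R) : `|(\1_A : R -> R) x| <= 1.
    by rewrite indicE; case: (_ \in _); rewrite ?normr1// normr0.
  (* The family of versions depends on both events; uniqueness of conditional
     expectations brings it back to the reference version [Vs]. *)
  have step1 (A : set R) (D' : set Omega) : measurable A -> G D' ->
      (\int[Pr]_(w in D') (\1_(W i @^-1` A) w * \1_(W j @^-1` B) w)%:E =
       \int[Pr]_(w in D') (\1_(W i @^-1` A) w * Vs w)%:E)%E.
    move=> mA GD'; have mD' := Gm GD'.
    have [V [VE [iprod iV GVV prodE]]] := ci _ (mfam A mA).
    have Vie := VE i; rewrite {1}/fam eqxx in Vie.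
    have [Vi_ae Vi] := cond_exp_indic Vie.
    have VsE : {ae Pr, forall w, V j w = Vs w}.
      by apply: cond_exp_uniq Vj; have := VE j; rewrite famj.
    have V1 t : t != i -> t != j -> {ae Pr, forall w, V t w = 1}.
      move=> ti tj; have := VE t; rewrite /fam (negbTE ti) (negbTE tj) => VtE.
      apply: cond_exp_uniq VtE _; rewrite preimage_setT.
      rewrite (_ : \1_setT = fun=> 1) ?indicT//.
      exact: cond_exp_cst.
    have prod_ae : {ae Pr, forall w, \prod_(t < k) V t w = clip (V i w) * Vs w}.
      have all1 : {ae Pr, forall w, forall t, t != i -> t != j -> V t w = 1}.
        apply: filter_forall => t; have [->|ti] := eqVneq t i.
          by apply: aeW.
        have [->|tj] := eqVneq t j; first by apply: aeW.
        by apply: filterS (V1 t ti tj).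
      move: all1; apply: filterS3 Vi_ae VsE => w /= vi vj v1.
      rewrite (bigD1 i)//= (bigD1 j) 1?eq_sym//= big1; last first.
        by move=> t /andP[ti tj]; exact: v1.
      by rewrite mulr1 -vi vj.
    have [iVi iVi' GVi _] := Vi.
    transitivity (\int[Pr]_(w in D') (clip (V i w) * Vs w)%:E)%E.
      transitivity (\int[Pr]_(w in D') (\prod_(t < k) V t w)%:E)%E.
        rewrite prodE// bigcapE; apply: eq_integral => w _; congr EFin.
        by rewrite -indicIM.
      apply: ae_eq_integral => //.
      - by apply: measurable_funTS; exact: measurable_int iV.
      - apply: measurable_funTS; apply/measurable_EFinP; apply: measurable_funM => //.
        exact: (sub_measurable_fun GVi).
      - by apply: filterS prod_ae => w /= ->.
    apply/esym; apply: (cond_exp_pull_out Vi GVs) => //.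
    + exact: integrable_bounded2.
    + exact: (integrable_bounded2 _ _ iVi').
  have mVB : measurable_fun setT (fun w => \1_(W j @^-1` B) w - Vs w : R).
    exact: measurable_funB.
  have iU : Pr.-integrable setT (EFin \o (fun w => \1_(W j @^-1` B) w - Vs w)).
    exact: (integrableB measurableT iBj iVs).
  have iWB : Pr.-integrable setT (EFin \o (fun w => W i w * \1_(W j @^-1` B) w)).
    exact: integrable_bounded2.
  have iWV : Pr.-integrable setT (EFin \o (fun w => W i w * Vs w)).
    exact: integrable_bounded2.
  have step2 : (\int[Pr]_w (\1_D w * (\1_(W j @^-1` B) w - Vs w) * W i w)%:E = 0)%E.
    apply: integral_mul_eq0 => //.
    - exact: integrable_indicM.
    - rewrite (_ : (fun s => _) = EFin \o (fun w => \1_D w *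
          (W i w * \1_(W j @^-1` B) w - W i w * Vs w))); last first.
        by apply/funext => w /=; congr EFin; ring.
      by apply: integrable_indicM => //; exact: (integrableB measurableT iWB iWV).
    - move=> A mA; rewrite integral_indicM.
      have iA (f : Omega -> R) : Pr.-integrable setT (EFin \o f) ->
          Pr.-integrable setT (EFin \o (fun w => \1_(W i @^-1` A) w * f w)).
        by apply: integrable_indicM; exact: mpre.
      under eq_integral do rewrite mulrCA mulrBr.
      apply/(integral_indicB mD (iA _ iBj) (iA _ iVs)).
      exact: step1.
  have -> : (\int[Pr]_(w in D) (W i w * \1_B (W j w))%:E =
      \int[Pr]_(w in D) (W i w * Vs w)%:E)%E.
    apply/(integral_indicB mD iWB iWV); rewrite -[RHS]step2.
    by apply: eq_integral => w _; congr EFin; ring.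
  rewrite (cond_exp_pull_out EWi GVs)//.
    by under eq_integral do rewrite mul0r; rewrite integral0.
  exact: integrable_bounded2.
rewrite integral_indicM; under eq_integral do rewrite mulrA.
apply: integral_mul_eq0 => //.
- exact: integrable_indicM.
- by under eq_fun do rewrite -mulrA; exact: integrable_indicM.
- move=> B mB; rewrite -(WiB B mB) integral_indicM [RHS]integral_indicM.
  by apply: eq_integral => w _; congr EFin; rewrite mulrCA [X in _ * X]mulrC.
Qed.

(** The conditional mean inside a conditional variance is an arbitrary version,
    but for a centred variable it is almost everywhere [0]. *)
Lemma cond_var_bound Y V (c : R) : is_cond_exp Pr G Y (fun=> 0) ->
  is_cond_var Pr G Y V -> {ae Pr, forall w, V w <= c} ->
  measurable_fun setT Y ->
  Pr.-integrable setT (EFin \o (fun w => Y w ^+ 2)) /\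
  forall D, G D -> (\int[Pr]_(w in D) (Y w ^+ 2)%:E <= c%:E * Pr D)%E.
Proof.
move=> EY [M EM EV] Vc mY.
have M0 := cond_exp_uniq EY EM.
have YM : {ae Pr, forall w, (Y w - M w) ^+ 2 = Y w ^+ 2}.
  by apply: filterS M0 => w /= <-; rewrite subr0.
have [i2 iV GV VE] := EV.
have mY2 : measurable_fun setT (fun w => Y w ^+ 2) by exact: measurable_funX.
have iY2 := integrable_ae_eq mY2 YM i2.
split => // D GD; have mD := Gm GD.
have -> : (\int[Pr]_(w in D) (Y w ^+ 2)%:E = \int[Pr]_(w in D) (V w)%:E)%E.
  rewrite VE//; apply: ae_eq_integral => //.
  - by apply: measurable_funTS; exact/measurable_EFinP.
  - by apply: measurable_funTS; exact: measurable_int i2.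
  - by apply: filterS YM => w /= ->.
have mVc : measurable_fun setT (fun w => Num.min (V w) c).
  by apply: measurable_minr => //; exact: sub_measurable_fun.
have VVc : {ae Pr, forall w, V w = Num.min (V w) c}.
  by apply: filterS Vc => w /= Vwc; rewrite min_l.
rewrite (ae_eq_integral (fun w => (Num.min (V w) c)%:E)) //; last 3 first.
- by apply: measurable_funTS; exact: measurable_int iV.
- by apply: measurable_funTS; exact/measurable_EFinP.
- by apply: filterS VVc => w /= vE _; congr EFin.
rewrite -integral_cst//; apply: le_integral => //.
- exact: (integrableS measurableT mD _ (integrable_ae_eq mVc VVc iV)).
- exact: finite_measure_integrable_cst.
- by move=> w _; rewrite lee_fin ge_min lexx orbT.
Qed.

End conditional_expectation.

(** * A maximal inequality for orthogonal noise *)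

Section block_sums.
Context (R : realType).

Lemma sqr_sum_le_size (I : Type) (s : seq I) (f : I -> R) :
  (\sum_(i <- s) f i) ^+ 2 <= (size s)%:R * \sum_(i <- s) f i ^+ 2.
Proof.
elim: s => [|x s IH]; first by rewrite !big_nil expr0n mul0r.
rewrite !big_cons /= -natr1.
have Q0 : 0 <= \sum_(i <- s) f i ^+ 2 by apply: sumr_ge0 => i _; exact: sqr_ge0.
move: IH Q0; set S := \sum_(i <- s) f i; set Q := \sum_(i <- s) _.
case: s @S @Q => [|y s] S Q IH Q0; first by rewrite /S /Q !big_nil !addr0 add0r mul1r.
have n1 : 1 <= (size (y :: s))%:R :> R by rewrite ler1n.
move: n1 IH; set n := (size _)%:R => n1 IH.
have h : 2 * f x * S <= n * f x ^+ 2 + Q.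
  rewrite -(ler_pM2l (lt_le_trans ltr01 n1)).
  have := sqr_ge0 (n * f x - S); nra.
nra.
Qed.

(** Comparison with the telescoping sum of [2 / (j (j + 1))]. *)
Lemma sum_inv_sqr_le (m N : nat) : (0 < m)%N -> (m <= N)%N ->
  \sum_(m <= j < N) (j%:R ^+ 2)^-1 <= 2 / m%:R - 2 / N%:R :> R.
Proof.
move=> m0; elim: N => [|N IH]; first by rewrite leqn0 => /eqP m00; rewrite m00 in m0.
rewrite leq_eqVlt => /predU1P[<-|]; first by rewrite big_geq// subrr.
rewrite ltnS => mN; rewrite big_nat_recr//=.
have N0 : 0 < N%:R :> R by rewrite ltr0n (leq_trans m0).
have N1 : 1 <= N%:R :> R by rewrite ler1n (leq_trans m0).
apply: (le_trans (lerD (IH mN) (lexx _))).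
rewrite -natr1 -addrA lerD2l -subr_ge0.
rewrite (_ : _ - _ = (N%:R - 1) / (N%:R ^+ 2 * (N%:R + 1))); last first.
  by field; lra.
by rewrite divr_ge0 ?subr_ge0// mulr_ge0 ?sqr_ge0// addr_ge0.
Qed.

(** The squares [j^2] are dense enough to control all partial sums: between
    two consecutive squares the increment is bounded by Cauchy-Schwarz. *)
Definition block_bound (I : Type) (f : I -> R) (s : seq I) (j : nat) : R :=
  (2 * (\sum_(i <- take (j ^ 2) s) f i) ^+ 2 +
   2 * (2 * j + 1)%:R * \sum_(i <- take (2 * j + 1) (drop (j ^ 2) s)) f i ^+ 2)
  / j%:R ^+ 4.

Lemma block_bound_ge0 (I : Type) (f : I -> R) s j : 0 <= block_bound f s j.
Proof.
rewrite divr_ge0 ?exprn_ge0// addr_ge0// mulr_ge0 ?sqr_ge0//.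
by apply: sumr_ge0 => i _; exact: sqr_ge0.
Qed.

Lemma sqr_between k : exists j, (j ^ 2 <= k < j.+1 ^ 2)%N.
Proof.
elim: k => [|k [j /andP[h1 h2]]]; first by exists 0%N.
have [h|h] := ltnP k.+1 (j.+1 ^ 2); first by exists j; rewrite h (leq_trans h1).
exists j.+1; rewrite h /=; apply: leq_ltn_trans (h2) _.
by rewrite ltn_sqr.
Qed.

(** If [j ^ 2 <= k < (j + 1) ^ 2] then the [k]-th partial sum differs from the
    [j ^ 2]-th one by at most [2 j + 1] terms, and [k] is at least [j ^ 2]. *)
Lemma sqr_partial_sum_le (I : Type) (f : I -> R) (s : seq I) (m k : nat) (eps : R) :
  (0 < m)%N -> (m ^ 2 <= k <= size s)%N -> 0 < eps ->
  eps * k%:R <= `|\sum_(i <- take k s) f i| ->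
  eps ^+ 2 <= \sum_(m <= j < (size s).+1) block_bound f s j.
Proof.
move=> m0 /andP[mk ks] eps0 hk.
have [j /andP[jk kj]] := sqr_between k.
have mj : (m <= j)%N by rewrite -ltnS -ltn_sqr (leq_ltn_trans mk).
have j0 : (0 < j)%N by apply: leq_trans mj.
have jk' : (j <= k)%N.
  by apply: leq_trans jk; rewrite -{1}[j]muln1 expnS expn1 leq_mul2l j0 orbT.
have jR : 0 < j%:R :> R by rewrite ltr0n.
have js : (j < (size s).+1)%N by rewrite ltnS (leq_trans jk').
have h : eps ^+ 2 <= block_bound f s j.
  rewrite ler_pdivlMr ?exprn_gt0//.
  set t := take (k - j ^ 2) (drop (j ^ 2) s).
  have tE : take k s = take (j ^ 2) s ++ t by rewrite -takeD subnKC.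
  have kj2 : (k - j ^ 2 <= 2 * j + 1)%N.
    rewrite leq_subLR -ltnS; apply: leq_trans kj _.
    by rewrite -addn1 sqrnD; lia.
  have bt : \sum_(i <- t) f i ^+ 2 <=
      \sum_(i <- take (2 * j + 1) (drop (j ^ 2) s)) f i ^+ 2.
    have -> : t = take (k - j ^ 2) (take (2 * j + 1) (drop (j ^ 2) s)).
      by rewrite take_takel.
    rewrite -{2}(cat_take_drop (k - j ^ 2) (take (2 * j + 1) _)) big_cat/= lerDl.
    by apply: sumr_ge0 => i _; exact: sqr_ge0.
  have st : (size t)%:R <= (2 * j + 1)%:R :> R.
    by rewrite ler_nat; apply: leq_trans kj2; rewrite size_take_min geq_minl.
  move: bt; set B := \sum_(i <- take (2 * j + 1) _) _ => bt.
  have hsq : (eps * k%:R) ^+ 2 <= (\sum_(i <- take k s) f i) ^+ 2.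
    rewrite -[leRHS]real_normK ?num_real// ler_sqr ?nnegrE//.
    by rewrite mulr_ge0// ltW.
  move: hsq; rewrite tE big_cat/= -/t.
  set S := \sum_(i <- take _ _) _; have := sqr_sum_le_size t f.
  set U := \sum_(i <- t) f i; set Q := \sum_(i <- t) _ in bt *.
  move=> UQ hsq.
  have Q0 : 0 <= Q by apply: sumr_ge0 => i _; exact: sqr_ge0.
  have UB : U ^+ 2 <= (2 * j + 1)%:R * B.
    by apply: (le_trans UQ); apply: ler_pM.
  have kj4 : j%:R ^+ 4 <= k%:R ^+ 2 :> R.
    by rewrite -!natrX ler_nat (expnM j 2 2) leq_sqr.
  have SU : (S + U) ^+ 2 <= 2 * S ^+ 2 + 2 * U ^+ 2.
    by have := sqr_ge0 (S - U); nra.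
  have e2 : eps ^+ 2 * j%:R ^+ 4 <= eps ^+ 2 * k%:R ^+ 2.
    by rewrite ler_wpM2l// sqr_ge0.
  rewrite exprMn in hsq; lra.
apply: (le_trans h).
rewrite [leRHS](@big_cat_nat _ _ _ j.+1) ?(leqW mj)//= big_nat_recr//=.
rewrite addrAC lerDr addr_ge0// sumr_ge0// => i _; exact: block_bound_ge0.
Qed.

End block_sums.

Section maximal_inequality.
Context d (Omega : measurableType d) (R : realType) (Pr : probability Omega R).
Context (k : nat) (W : 'I_k -> Omega -> R) (D : set Omega) (c : R).
Hypothesis (c0 : 0 <= c) (mD : measurable D) (mW : forall i, measurable_fun setT (W i)).
Hypothesis (iWW : forall i j,
  Pr.-integrable setT (EFin \o (fun w => W i w * W j w))).
Hypothesis (W_orth : forall i j, i != j ->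
  (\int[Pr]_(w in D) (W i w * W j w)%:E = 0)%E).
Hypothesis (W_var : forall i,
  (\int[Pr]_(w in D) (W i w ^+ 2)%:E <= c%:E * Pr D)%E).

Let sum_const (s : seq 'I_k) :
  (((size s)%:R * c)%:E * Pr D = \sum_(i <- s) (c%:E * Pr D))%E.
Proof.
elim: s => [|i s IH]; first by rewrite big_nil mul0r mul0e.
rewrite big_cons -IH -ge0_muleDl ?lee_fin ?mulr_ge0//; congr (_ * _)%E.
by rewrite /= -natr1 -EFinD; congr EFin; ring.
Qed.

(** Expanding the square, orthogonality removes the mixed terms. *)
Lemma integral_sqr_sum_le (s : seq 'I_k) : uniq s ->
  (\int[Pr]_(w in D) ((\sum_(i <- s) W i w) ^+ 2)%:E <=
   ((size s)%:R * c)%:E * Pr D)%E.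
Proof.
move=> us; have iWWD i j : Pr.-integrable D (fun w => (W i w * W j w)%:E).
  by apply: (integrableS measurableT mD _ (iWW i j)).
under eq_integral do rewrite expr2 big_distrlr/= -sumEFin.
rewrite integral_sum//; last first.
  by move=> i; under eq_fun do rewrite -sumEFin; exact: integrable_sum.
rewrite (_ : ((size s)%:R * c)%:E * Pr D = \sum_(i <- s) (c%:E * Pr D))%E.
  rewrite big_seq [leRHS]big_seq; apply: lee_sum => i si.
  under eq_integral do rewrite -sumEFin.
  rewrite integral_sum//.
  rewrite (bigD1_seq i)//= big1 ?adde0; first exact: W_var.
  by move=> j; rewrite eq_sym => ij; exact: W_orth.
exact: sum_const.
Qed.

Lemma measurable_block_bound (s : seq 'I_k) j :
  measurable_fun setT (fun w => block_bound (W^~ w) s j).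
Proof.
apply: measurable_funM => //; apply: measurable_funD.
  by apply: measurable_funM => //; apply: measurable_funX; exact: measurable_sum.
apply: measurable_funM => //.
by apply: measurable_sum => i; exact: measurable_funX.
Qed.

(** The constant is [2 j ^ 2 + 2 (2 j + 1) ^ 2 <= 20 j ^ 2]. *)
Lemma integral_block_bound_le (s : seq 'I_k) j : uniq s -> (0 < j)%N ->
  (\int[Pr]_(w in D) (block_bound (W^~ w) s j)%:E <=
   (20 * c / j%:R ^+ 2)%:E * Pr D)%E.
Proof.
move=> us j0; rewrite /block_bound.
set u := take _ _; set v := take _ _.
have uu : uniq u by exact: take_uniq.
have uv : uniq v by apply: take_uniq; exact: drop_uniq.
have mu_ : measurable_fun setT (fun w => (\sum_(i <- u) W i w) ^+ 2).
  by apply: measurable_funX; exact: measurable_sum.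
have mv_ : measurable_fun setT (fun w => \sum_(i <- v) W i w ^+ 2).
  by apply: measurable_sum => i; exact: measurable_funX.
have jR : 0 < j%:R :> R by rewrite ltr0n.
have u0 w : 0 <= (\sum_(i <- u) W i w) ^+ 2 by exact: sqr_ge0.
have v0 w : 0 <= \sum_(i <- v) W i w ^+ 2.
  by apply: sumr_ge0 => i _; exact: sqr_ge0.
pose a : R := 2 / j%:R ^+ 4.
pose b : R := 2 * (2 * j + 1)%:R / j%:R ^+ 4.
have a0 : 0 <= a by rewrite divr_ge0// exprn_ge0.
have b0 : 0 <= b by rewrite divr_ge0// exprn_ge0.
rewrite (eq_integral (fun w => a%:E * ((\sum_(i <- u) W i w) ^+ 2)%:E +
    b%:E * (\sum_(i <- v) W i w ^+ 2)%:E)%E); last first.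
  by move=> w _; rewrite -!EFinM -EFinD; congr EFin; rewrite /a /b; ring.
have mE (f : Omega -> R) : measurable_fun setT f -> measurable_fun D (EFin \o f).
  by move=> mf; apply: measurable_funTS; exact/measurable_EFinP.
rewrite ge0_integralD//; first last.
- by apply: measurable_funeM; exact: mE.
- by move=> w _; rewrite mule_ge0 ?lee_fin.
- by apply: measurable_funeM; exact: mE.
- by move=> w _; rewrite mule_ge0 ?lee_fin.
rewrite !ge0_integralZl_EFin//; first last.
- exact: mE.
- by move=> w _; rewrite lee_fin.
- exact: mE.
- by move=> w _; rewrite lee_fin.
have hu := integral_sqr_sum_le uu.
have hv : (\int[Pr]_(w in D) (\sum_(i <- v) W i w ^+ 2)%:E <=
    ((size v)%:R * c)%:E * Pr D)%E.
  under eq_integral do rewrite -sumEFin.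
  rewrite ge0_integral_sum//; first last.
  - by move=> i w _; rewrite lee_fin sqr_ge0.
  - by move=> i; apply: mE; exact: measurable_funX.
  rewrite (_ : ((size v)%:R * c)%:E * Pr D = \sum_(i <- v) (c%:E * Pr D))%E.
    by apply: lee_sum => i _; exact: W_var.
  exact: sum_const.
have su : (size u)%:R <= j%:R ^+ 2 :> R.
  by rewrite -natrX ler_nat size_take_min geq_minl.
have sv : (size v)%:R <= (2 * j + 1)%:R :> R.
  by rewrite ler_nat size_take_min geq_minl.
apply: (@le_trans _ _ ((a * (j%:R ^+ 2 * c))%:E * Pr D +
    (b * ((2 * j + 1)%:R * c))%:E * Pr D)%E).
  apply: leeD; rewrite (EFinM _ (_ * c)) -muleA lee_wpmul2l ?lee_fin//.
    by apply: (le_trans hu); rewrite lee_wpmul2r// lee_fin ler_wpM2r.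
  by apply: (le_trans hv); rewrite lee_wpmul2r// lee_fin ler_wpM2r.
rewrite -ge0_muleDl ?lee_fin ?mulr_ge0 ?exprn_ge0//.
rewrite lee_wpmul2r// -EFinD lee_fin.
have j1 : 1 <= j%:R :> R by rewrite ler1n.
have h9 : (2 * j + 1)%:R ^+ 2 <= 9 * j%:R ^+ 2 :> R.
  by rewrite natrD natrM; nra.
rewrite (_ : 20 * c / j%:R ^+ 2 = 20 * j%:R ^+ 2 * c / j%:R ^+ 4); last first.
  by field; rewrite gt_eqF.
rewrite (_ : _ + _ = (2 * j%:R ^+ 2 + 2 * (2 * j + 1)%:R ^+ 2) * c / j%:R ^+ 4).
  by rewrite ler_wpM2r ?invr_ge0 ?exprn_ge0// ler_wpM2r//; lra.
by rewrite /a /b; ring.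
Qed.

(** Uniform control of all means over at least [m ^ 2] terms follows from Markov's
    inequality for the sum over [j >= m] of the block bounds, since the expectation
    of the [j]-th one is of order [j ^- 2].  The constant [40] is [20] times the
    bound [2 / m] on that tail. *)
Lemma maximal_inequality_on_event (s : seq 'I_k) (m : nat) (eps : R) :
  uniq s -> (0 < m)%N -> 0 < eps ->
  exists A : set Omega,
    [/\ measurable A,
        (Pr A <= (40 * c / (eps ^+ 2 * m%:R))%:E * Pr D)%E &
        forall w, D w ->
          (exists2 l, (m ^ 2 <= l <= size s)%N &
             eps * l%:R <= `|\sum_(i <- take l s) W i w|) -> A w].
Proof.
move=> us m0 eps0.
pose Phi w := \sum_(m <= j < (size s).+1) block_bound (W^~ w) s j.
have mPhi : measurable_fun setT Phi.
  by apply: measurable_sum => j; exact: measurable_block_bound.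
have Phi0 w : 0 <= Phi w by apply: sumr_ge0 => j _; exact: block_bound_ge0.
have mR : 0 < m%:R :> R by rewrite ltr0n.
have IPhi : (\int[Pr]_(w in D) (Phi w)%:E <= (40 * c / m%:R)%:E * Pr D)%E.
  under eq_integral do rewrite -sumEFin.
  rewrite ge0_integral_sum//; first last.
  - by move=> j w _; rewrite lee_fin block_bound_ge0.
  - move=> j; apply: measurable_funTS; apply/measurable_EFinP.
    exact: measurable_block_bound.
  apply: (@le_trans _ _
      (\sum_(j <- index_iota m (size s).+1) (20 * c / j%:R ^+ 2)%:E * Pr D)%E).
    rewrite big_seq [leRHS]big_seq; apply: lee_sum => j.
    rewrite mem_index_iota => /andP[mj _]; apply: integral_block_bound_le => //.
    exact: leq_trans mj.
  rewrite -ge0_sume_distrl; last first.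
    by move=> j _; rewrite lee_fin divr_ge0 ?mulr_ge0 ?sqr_ge0.
  rewrite lee_wpmul2r// sumEFin lee_fin -mulr_sumr.
  rewrite (_ : 40 * c / m%:R = 20 * c * (2 / m%:R)); last by ring.
  rewrite ler_wpM2l ?mulr_ge0//.
  have [ms|sm] := leqP m (size s).+1; last by rewrite big_geq ?divr_ge0// ltnW.
  apply: (le_trans (@sum_inv_sqr_le R _ _ m0 ms)).
  by rewrite gerBl divr_ge0.
exists (D `&` [set w | ((eps ^+ 2)%:E <= `|(Phi w)%:E|)%E]).
have mPhiD : measurable_fun D (EFin \o Phi).
  by apply: measurable_funTS; exact/measurable_EFinP.
have e2 : 0 < eps ^+ 2 by rewrite exprn_gt0.
split.
- by apply: emeasurable_fun_c_infty => //; exact: measurableT_comp.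
- rewrite (_ : 40 * c / _ = (eps ^+ 2)^-1 * (40 * c / m%:R)); last first.
    by field; rewrite !gt_eqF.
  rewrite (EFinM (eps ^+ 2)^-1) -muleA lee_pdivlMl//; apply: le_trans IPhi.
  have := le_integral_abse Pr mD mPhiD e2; rewrite /comp.
  by under [X in (_ <= X)%E]eq_integral do rewrite gee0_abs ?lee_fin//.
- move=> w Dw [l ml hl]; split => //=.
  rewrite lee_fin ger0_norm//; exact: sqr_partial_sum_le hl.
Qed.

End maximal_inequality.

(** Turns blocks of sites on the line into initial segments of a sorted list, the
    form in which partial sums are controlled. *)
Lemma filter_prefix (T : eqType) (r : rel T) (P : pred T) (s : seq T) :
  transitive r -> sorted r s ->
  (forall x y, x \in s -> y \in s -> P y -> r x y -> P x) ->
  [seq x <- s | P x] = take (count P s) s.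
Proof.
move=> tr; elim: s => [//|x s IH] /= ps Plow.
have xs := order_path_min tr ps.
case: ifPn => Px; rewrite ?add1n ?add0n /=.
  rewrite -IH//; first exact: path_sorted ps.
  by move=> y z ys zs; apply: Plow; rewrite inE ?ys ?zs orbT.
have Ps : {in s, P =1 pred0}.
  move=> y ys; apply/negbTE; apply: contra Px => Py; apply: Plow Py _.
  - by rewrite inE eqxx.
  - by rewrite inE ys orbT.
  - exact: (allP xs).
by rewrite (eq_in_filter Ps) filter_pred0 (eq_in_count Ps) count_pred0 take0.
Qed.

(** The order in which the sites [key i] lie on the line is random, but takes
    finitely many values, each on an event of [G].  The bound for a fixed order
    is proportional to the probability of that event, so it can be summed. *)
Lemma maximal_inequality d (Omega : measurableType d) (R : realType)
    (Pr : probability Omega R) (G : set (set Omega)) (k : nat)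
    (W key : 'I_k -> Omega -> R) (c : R) (J : set R) (m : nat) (eps : R) :
  sigma_algebra setT G -> G `<=` measurable -> measurable J ->
  (forall i, measurable_fun setT (W i)) ->
  (forall i B, measurable B -> G (key i @^-1` B)) ->
  (forall i j, Pr.-integrable setT (EFin \o (fun w => W i w * W j w))) ->
  (forall i j D, i != j -> G D ->
     (\int[Pr]_(w in D) (W i w * W j w)%:E = 0)%E) ->
  (forall i D, G D -> (\int[Pr]_(w in D) (W i w ^+ 2)%:E <= c%:E * Pr D)%E) ->
  0 <= c -> (0 < m)%N -> 0 < eps ->
  exists A : set Omega,
    [/\ measurable A, (Pr A <= (40 * c / (eps ^+ 2 * m%:R))%:E)%E &
      forall w (S : {set 'I_k}), (m ^ 2 <= #|S|)%N ->
        (forall i, i \in S -> J (key i w)) ->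
        (forall i j, J (key i w) -> j \in S -> key i w <= key j w -> i \in S) ->
        eps * #|S|%:R <= `|\sum_(i in S) W i w| -> A w].
Proof.
move=> sG Gm mJ mW Gkey iWW W_orth W_var c0 m0 eps0.
(* [sig w] records the order of the sites and which of them lie in [J]. *)
pose sigT := ({ffun 'I_k * 'I_k -> bool} * {ffun 'I_k -> bool})%type.
pose sig w : sigT := ([ffun p => key p.1 w <= key p.2 w], [ffun i => key i w \in J]).
pose D (x : sigT) := [set w | sig w = x].
have Gfin (I : finType) (F : I -> set Omega) : (forall i, G (F i)) ->
    G [set w | forall i, F i w].
  rewrite (_ : G = @measurable _ (g_sigma_algebraType G)); last first.
    by rewrite measurable_g_measurableTypeE.
  move=> GF; rewrite (_ : [set w | _] = \bigcap_(i in [set: I]) F i).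
    by apply: fin_bigcap_measurable => // i _; exact: GF.
  by apply/seteqP; split => [w Fw i _|w Fw i]; exact: Fw.
have Gbool (b : Omega -> bool) e : G [set w | b w] -> G [set w | b w = e].
  have [_ GC _] := sG; case: e => // Gb.
  rewrite (_ : [set w | _] = [set: Omega] `\` [set w | b w]); first exact: GC.
  by apply/seteqP; split => [w /= ->|w /= [_ /negP/negbTE]].
have GD x : G (D x).
  rewrite (_ : D x = [set w | forall p, (key p.1 w <= key p.2 w) = x.1 p] `&`
      [set w | forall i, (key i w \in J) = x.2 i]); last first.
    apply/seteqP; split => [w <-|w [h1 h2]].
      by split=> [p|i] /=; rewrite ffunE.
    rewrite /D /= /sig [RHS]surjective_pairing; congr pair.
      by apply/ffunP => p; rewrite ffunE; exact: h1.
    by apply/ffunP => i; rewrite ffunE; exact: h2.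
  apply: sigma_algebra_setI => //; apply: Gfin => i; apply: Gbool.
    have [_ GC _] := sG.
    rewrite (_ : [set w | _] =
        [set: Omega] `\` [set w | key i.2 w < key i.1 w]).
      by apply: GC; apply: sigma_algebra_lt => // B mB; exact: Gkey.
    apply/seteqP; split => [w /= h|w /= [_ /negP]]; last by rewrite -leNgt.
    by split => //; apply/negP; rewrite -leNgt.
  rewrite (_ : [set w | _] = key i @^-1` J); first exact: Gkey.
  by apply/seteqP; split => w /=; rewrite inE.
pose L (x : sigT) := sort (fun i j => x.1 (i, j)) [seq i <- enum 'I_k | x.2 i].
have uL x : uniq (L x) by rewrite sort_uniq filter_uniq// enum_uniq.
have ch x := maximal_inequality_on_event c0 (Gm _ (GD x)) mW iWW
  (fun i j ij => W_orth i j (D x) ij (GD x)) (fun i => W_var i (D x) (GD x))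
  (uL x) m0 eps0.
pose A x := projT1 (cid (ch x)).
have AP x := projT2 (cid (ch x)).
set K : R := 40 * c / _.
have K0 : 0 <= K.
  by apply: divr_ge0; apply: mulr_ge0 => //; exact: sqr_ge0.
exists (\big[setU/set0]_x A x); split.
- by apply: bigsetU_measurable => x _; have [] := AP x.
- have mA x : measurable (A x) by have [] := AP x.
  have sub (s : seq sigT) : (Pr (\big[setU/set0]_(x <- s) A x) <=
      \sum_(x <- s) Pr (A x))%E.
    elim: s => [|x s IH]; first by rewrite !big_nil measure0.
    rewrite !big_cons; apply: (le_trans (measureU2 _ _ _)) => //.
      by apply: bigsetU_measurable.
    exact: leeD.
  apply: (le_trans (sub _)).
  apply: (@le_trans _ _ (\sum_x K%:E * Pr (D x))%E).
    by apply: lee_sum => x _; have [] := AP x.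
  rewrite -ge0_sume_distrr; last by move=> x _; exact: measure_ge0.
  rewrite -[leRHS]mule1 lee_wpmul2l ?lee_fin//.
  have mDx x : measurable (D x) by apply: Gm.
  rewrite (eq_bigr (fun x => \int[Pr]_w (\1_(D x) w)%:E)%E); last first.
    by move=> x _; rewrite integral_indic// setIT.
  rewrite -ge0_integral_sum//; last first.
    by move=> x; apply/measurable_EFinP; exact: measurable_indic.
  rewrite (eq_integral (cst 1%E)); last first.
    move=> w _; rewrite (bigD1 (sig w))//= big1 ?adde0.
      by rewrite indicE mem_set.
    move=> x xs; rewrite indicE memNset//= => sx; move: xs.
    by rewrite -sx eqxx.
  by rewrite integral_cst//= mul1e probability_setT.
- move=> w S mS SJ Slow hS.
  have [_ _ Aw] := AP (sig w).
  rewrite (bigD1 (sig w))//=; left; apply: Aw; first by [].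
  have LE : L (sig w) = sort (fun i j => key i w <= key j w)
      [seq i <- enum 'I_k | key i w \in J].
    rewrite /L /sig /=; congr (sort _ _).
      by apply/funext => i; apply/funext => j; rewrite ffunE.
    by apply: eq_filter => i; rewrite ffunE.
  have memL i : i \in L (sig w) -> J (key i w).
    by rewrite LE mem_sort mem_filter => /andP[]; rewrite inE.
  have pre : [seq i <- L (sig w) | i \in S] =
      take (count (mem S) (L (sig w))) (L (sig w)).
    apply: (@filter_prefix _ (fun i j => key i w <= key j w) (mem S)).
    - by move=> ? ? ?; exact: le_trans.
    - by rewrite LE; apply: sort_sorted => i j; exact: le_total.
    - by move=> i j iL _; apply: Slow; exact: memL.
  have pe : perm_eq [seq i <- L (sig w) | i \in S] (enum S).
    apply: uniq_perm; [by rewrite filter_uniq|exact: enum_uniq|move=> i].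
    rewrite mem_filter mem_enum; have [iS|//] := boolP (i \in S).
    by rewrite LE mem_sort mem_filter mem_enum mem_set//; exact: SJ.
  have cE : count (mem S) (L (sig w)) = #|S|.
    by rewrite -size_filter (perm_size pe) -cardE.
  exists #|S|; first by rewrite mS/= -cE count_size.
  rewrite -{2}cE -pre (perm_big _ pe)/=; apply: le_trans hS _.
  by rewrite big_enum.
Qed.

(** * Markov chains and recurrence *)

Lemma mem_preimage (aT rT : Type) (f : aT -> rT) (A : set rT) x :
  (x \in f @^-1` A) = (f x \in A).
Proof. by apply/idP/idP; rewrite !inE. Qed.

Section null_integrals.
Local Open Scope ereal_scope.
Context d (T : measurableType d) (R : realType) (m : {measure set T -> \bar R}).

Lemma ge0_integral_eq0P (D : set T) (f : T -> \bar R) : measurable D -> nnmeas f ->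
  (\int[m]_(x in D) f x = 0) <-> m (D `&` [set x | f x != 0]) = 0.
Proof.
move=> mD [mf f0]; have mfD : measurable_fun D f by exact: measurable_funTS.
have mDf : measurable (D `&` [set x | f x != 0]).
  by apply: measurable_neqe => //; exact: measurable_cst.
split => [I0|m0].
  have /(ae_eq_integral_abs _ mD mfD) [N [mN N0 DN]] : \int[m]_(x in D) `|f x| = 0.
    by rewrite -[RHS]I0; apply: eq_integral => x _; rewrite gee0_abs.
  apply: (subset_measure0 mDf mN _ N0) => x [Dx fx]; apply: DN => /= /(_ Dx) fx0.
  by move: fx; rewrite /= fx0 eqxx.
have /(ae_eq_integral_abs _ mD mfD) : ae_eq m D f (cst 0).
  exists (D `&` [set x | f x != 0]); split => // x /= /not_implyP[Dx fx].
  by split => //; exact/eqP.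
by move=> <-; apply: eq_integral => x _; rewrite gee0_abs.
Qed.

Lemma ge0_integral_pinfty (D : set T) (f : T -> \bar R) : measurable D -> nnmeas f ->
  \int[m]_(x in D) f x < +oo -> m (D `&` [set x | f x = +oo]) = 0.
Proof.
move=> mD [mf f0] If.
have mA : measurable (D `&` [set x | f x = +oo]).
  rewrite (_ : [set x | _] = f @^-1` [set +oo]); last by apply/seteqP; split.
  exact: (measurable_funTS mf).
apply/eqP; apply: contraTT If => mA0; rewrite -leNgt.
have -> : +oo = \int[m]_(x in D `&` [set x | f x = +oo]) (cst +oo) x.
  by rewrite integral_cst// gt0_mulye// lt0e mA0 measure_ge0.
rewrite (eq_integral f); last by move=> x /[!inE] -[_ /= ->].
apply: ge0_subset_integral => //; exact: measurable_funTS.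
Qed.

Lemma measure_setI_conull (A B : set T) : measurable A -> measurable B ->
  m (~` B) = 0 -> m (A `&` B) = m A.
Proof.
move=> mA mB m0; transitivity (m (A `\` B) + m (A `&` B)); last first.
  by apply/esym; exact: measureDI.
rewrite (_ : m (A `\` B) = 0) ?add0e//.
apply: (subset_measure0 _ _ _ m0) => //; first exact: measurableD.
exact: measurableC.
Qed.

Lemma measure0_setU (A B : set T) : measurable A -> measurable B ->
  m A = 0 -> m B = 0 -> m (A `|` B) = 0.
Proof. by move=> mA mB A0 B0; rewrite null_set_setU. Qed.

Lemma measure0_bigcup (F : (set T)^nat) : (forall n, measurable (F n)) ->
  (forall n, m (F n) = 0) -> m (\bigcup_n F n) = 0.
Proof.
move=> mF F0; apply/eqP; rewrite eq_le measure_ge0 andbT.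
apply: (le_trans (measure_sigma_subadditive m mF _ (@subset_refl _ _))).
  exact: bigcupT_measurable.
by rewrite eseries0// => n _ _; exact: F0.
Qed.

End null_integrals.

Section kernel_iterates.
Local Open Scope ereal_scope.
Context (R : realType) (E : set R) (P : R.-pker R ~> R).
Hypothesis hP : transition_kernel E P.

Let mE : measurable E. Proof. by case: hP. Qed.

Lemma nnmeas_kernel_integral (f : R -> \bar R) : nnmeas f ->
  nnmeas (fun x => \int[P x]_y f y).
Proof.
move=> [mf f0]; split; last by move=> x; exact: integral_ge0.
apply: (measurable_fun_integral_kernel (l := P)) => // U mU.
exact: measurable_kernel.
Qed.

Lemma nnmeas_kernel_iter n (A : set R) : measurable A ->
  nnmeas (fun x => kernel_iter P n x A).
Proof.
move=> mA; elim: n => [|n IH] /=; last exact: nnmeas_kernel_integral.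
rewrite (_ : (fun x => _) = fun x => (\1_A x)%:E); first exact: nnmeas_indic.
by apply/funext => x; rewrite diracE indicE.
Qed.

Lemma kernel_iter1 x (A : set R) : measurable A -> kernel_iter P 1 x A = P x A.
Proof.
move=> mA /=; rewrite (eq_integral (fun y => (\1_A y)%:E)).
  by rewrite integral_indic// setIT.
by move=> y _; rewrite diracE indicE.
Qed.

Lemma kernel_setC x : E x -> P x (~` E) = 0.
Proof.
move=> Ex; have [_ /(_ _ Ex) PE] := hP.
have PT : P x [set: R] = 1 by exact: prob_kernel.
rewrite -setTD measureD//; last by apply: le_lt_trans (ltry 1); rewrite -PT.
rewrite setTI -[RHS](@subee _ 1)//; congr (_ - _); first exact: PT.
exact: PE.
Qed.

Lemma kernel_setI x (A : set R) : measurable A -> E x -> P x (A `&` E) = P x A.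
Proof.
by move=> mA Ex; apply: measure_setI_conull => //; exact: kernel_setC.
Qed.

End kernel_iterates.

Section markov_property.
Local Open Scope ereal_scope.
Context (R : realType) (E : set R) (P : R.-pker R ~> R).
Context d (Omega : measurableType d) (Pr : probability Omega R)
  (X : nat -> {RV Pr >-> R}).
Hypotheses (hP : transition_kernel E P) (hX : markov_chain E P X).

Lemma natural_filtration_sigma n : sigma_algebra setT (natural_filtration X n).
Proof. exact: smallest_sigma_algebra. Qed.

Lemma natural_filtration_preimage n i (B : set R) : (i <= n)%N -> measurable B ->
  natural_filtration X n (X i @^-1` B).
Proof.
move=> lin mB; apply: sub_sigma_algebra.
have lin' : (i < n.+1)%N by [].
rewrite (bigD1 (Ordinal lin'))//=; left; exists B => //.
by rewrite setTI.
Qed.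

Lemma natural_filtration_measurable n : natural_filtration X n `<=` measurable.
Proof.
apply: smallest_sub; first exact: sigma_algebra_measurable.
elim/big_ind: _ => // [A B hA hB|i _]; first by rewrite subUset.
by move=> _ [B mB <-]; rewrite setTI; exact: measurable_funPTI.
Qed.

Lemma natural_filtration_mono m n : (m <= n)%N ->
  natural_filtration X m `<=` natural_filtration X n.
Proof.
move=> mn; apply: smallest_sub; first exact: natural_filtration_sigma.
elim/big_ind: _ => // [A B hA hB|i _]; first by rewrite subUset.
move=> _ [B mB <-]; rewrite setTI; apply: natural_filtration_preimage => //.
by rewrite -ltnS (leq_trans (ltn_ord i)).
Qed.

(** The Markov property for events determines both sides as functionals of [f]. *)
Lemma markov_integral n D (f : R -> \bar R) : natural_filtration X n D -> nnmeas f ->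
  \int[Pr]_(w in D) f (X n.+1 w) = \int[Pr]_(w in D) \int[P (X n w)]_y f y.
Proof.
move=> FD; have mD := natural_filtration_measurable FD.
have [XE hmark] := hX; have [mE PE] := hP.
apply: (integral_like_ext (integral_like_comp Pr _ _)
  (integral_like_kernel Pr P _ _)) => //.
- exact: measurable_funTS.
- exact: measurable_funTS.
- move=> B mB; have mBE : measurable (B `&` E) by exact: measurableI.
  have [_ _ _ /(_ _ FD) H] := hmark n (B `&` E) mBE (@subIsetr _ _ _).
  transitivity (\int[Pr]_(x in D) (\1_(X n.+1 @^-1` (B `&` E)) x)%:E).
    apply: eq_integral => w _; congr EFin.
    by rewrite !indicE; congr ((nat_of_bool _)%:R); apply/idP/idP; rewrite !inE /=;
      [move=> ?; split|case].
  rewrite -H; apply: eq_integral => w _.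
  rewrite integral_indic// setIT fineK; first by rewrite (kernel_setI hP).
  exact: (finite_kernel_measure P).
Qed.

Lemma kernel_iter_law k n D (B : set R) : natural_filtration X n D ->
  measurable B -> \int[Pr]_(w in D) kernel_iter P k (X n w) B =
    Pr (D `&` X (n + k)%N @^-1` B).
Proof.
move=> + mB; elim: k n D => [|k IH] n D FD /=.
  have mD := natural_filtration_measurable FD.
  rewrite addn0; transitivity (\int[Pr]_(w in D) (\1_(X n @^-1` B) w)%:E).
    apply: eq_integral => w _; by rewrite diracE indicE mem_preimage.
  by rewrite integral_indic//; [rewrite setIC|exact: measurable_funPTI].
rewrite -(markov_integral FD (nnmeas_kernel_iter P k mB)) addnS -addSn.
by apply: IH; exact: natural_filtration_mono FD.
Qed.

(** [avoid A k x] is the probability that a chain started at [x] is outside [A]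
    at the times [1, .., k]; expressing it through the kernel transfers Harris
    recurrence from one realization of the chain to any other. *)
Fixpoint avoid (A : set R) (k : nat) (x : R) : \bar R :=
  if k is k'.+1 then \int[P x]_y ((\1_(~` A) y)%:E * avoid A k' y) else 1.

Lemma nnmeas_avoid A k : measurable A -> nnmeas (avoid A k).
Proof.
move=> mA; elim: k => [|k [mk k0]] /=; first by split => // x; rewrite lee01.
apply: nnmeas_kernel_integral; split; last by move=> y; rewrite mule_ge0 ?lee_fin.
apply: emeasurable_funM => //; apply/measurable_EFinP.
by apply: measurable_indic; exact: measurableC.
Qed.

Lemma avoid_law k n D A : natural_filtration X n D -> measurable A ->
  \int[Pr]_(w in D) avoid A k (X n w) =
  Pr (D `&` [set w | forall j, (n < j <= n + k)%N -> ~ A (X j w)]).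
Proof.
move=> + mA; elim: k n D => [|k IH] n D FD.
  rewrite integral_cst ?mul1e; last exact: natural_filtration_measurable FD.
  congr (Pr _); apply/seteqP; split => [w Dw|w [] //]; split => // j.
  by rewrite addn0 => /andP[h1 h2]; have := leq_trans h1 h2; rewrite ltnn.
have mD := natural_filtration_measurable FD.
have FD' : natural_filtration X n.+1 (D `&` X n.+1 @^-1` (~` A)).
  apply: (sigma_algebra_setI (natural_filtration_sigma _)).
    exact: natural_filtration_mono FD.
  by apply: natural_filtration_preimage => //; exact: measurableC.
have nn : nnmeas (fun y => (\1_(~` A) y)%:E * avoid A k y).
  have [mk k0] := nnmeas_avoid k mA.
  split; last by move=> y; rewrite mule_ge0 ?lee_fin.
  apply: emeasurable_funM => //; apply/measurable_EFinP.
  by apply: measurable_indic; exact: measurableC.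
transitivity (\int[Pr]_(w in D `&` X n.+1 @^-1` (~` A)) avoid A k (X n.+1 w)).
  rewrite /= -(markov_integral FD nn) integral_mkcondr.
  apply: eq_integral => w _; rewrite /patch indicE.
  by rewrite -mem_preimage; case: ifPn => _; rewrite ?mul1e ?mul0e.
rewrite IH//; congr (Pr _); apply/seteqP; split => w.
  move=> [[Dw nA] h]; split => // j /andP[nj jk].
  have [->//|jn] := eqVneq j n.+1; apply: h.
  by rewrite ltn_neqAle eq_sym jn nj addSnnS.
move=> [Dw h]; split; first by split => //; apply: h; lia.
by move=> j jk; apply: h; lia.
Qed.

Lemma measurable_avoid n k (A : set R) : measurable A ->
  measurable [set w | forall j, (n < j <= n + k)%N -> ~ A (X j w)].
Proof.
move=> mA; rewrite (_ : [set w | _] =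
    \bigcap_(j in [set j | (n < j <= n + k)%N]) X j @^-1` (~` A)); last first.
  by apply/seteqP; split.
apply: bigcap_measurableType => j _.
by apply: measurable_funPTI; exact: measurableC.
Qed.

Lemma avoid_le1 A k x : measurable A -> avoid A k x <= 1.
Proof.
move=> mA; elim: k x => [//|k IH] x /=.
have [mk k0] := nnmeas_avoid k mA.
have -> : 1 = \int[P x]_y (cst 1 y).
  by rewrite integral_cst// mul1e; apply/esym; exact: prob_kernel.
apply: ge0_le_integral => //.
- by move=> y _; rewrite mule_ge0 ?lee_fin.
- apply: emeasurable_funM => //; apply/measurable_EFinP.
  by apply: measurable_indic; exact: measurableC.
- move=> y _; rewrite -[leRHS]mule1; apply: lee_pmul => //.
  by rewrite lee_fin indicE; case: (_ \in _).
Qed.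

Lemma integral_initial x (f : R -> \bar R) : Pr (X 0%N @^-1` [set x]) = 1 ->
  nnmeas f -> \int[Pr]_w f (X 0%N w) = f x.
Proof.
move=> X0x [mf f0].
transitivity (\int[Pr]_w cst (f x) w).
  apply: ae_eq_integral => //.
  - exact: measurableT_comp.
  - exists (~` (X 0%N @^-1` [set x])); split.
    + by apply: measurableC; exact: measurable_funPTI.
    + transitivity (1 - Pr (X 0%N @^-1` [set x])); last by rewrite X0x subee.
      by apply: probability_setC; exact: measurable_funPTI.
    + by move=> w /= h X0; apply: h => _; rewrite X0.
by rewrite integral_cst//= probability_setT mule1.
Qed.

End markov_property.

Section recurrence.
Local Open Scope ereal_scope.
Context (R : realType) (E : set R) (P : R.-pker R ~> R).
Context (psi : {measure set R -> \bar R}).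
Hypotheses (hP : transition_kernel E P) (hH : harris_recurrent E P psi).

(** By the Borel-Cantelli lemma a finite expected number of visits would
    contradict the infinitely many visits of a Harris recurrent chain. *)
Lemma sum_kernel_iter_pinfty x (B : set R) : E x -> measurable B -> B `<=` E ->
  0 < psi B -> \sum_(n <oo) kernel_iter P n x B = +oo.
Proof.
move=> Ex mB BE pB; have [d [Om [Q [X [hX X0x rec]]]]] := hH Ex.
apply/eqP; apply: contraT; rewrite -ltey => fin.
have mX n : measurable (X n @^-1` B) by exact: measurable_funPTI.
have QX n : Q (X n @^-1` B) = kernel_iter P n x B.
  have F0 := sigma_algebra_setT (natural_filtration_sigma X 0).
  have := kernel_iter_law hP hX n F0 mB.
  rewrite setTI add0n => <-.
  exact: (integral_initial X0x (nnmeas_kernel_iter P n mB)).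
have : Q (lim_sup_set (fun n => X n @^-1` B)) = 0.
  apply: lim_sup_set_cvg0 => //.
  by rewrite (eq_eseriesr (fun n _ => QX n)).
by rewrite rec// => /eqP; rewrite eqe oner_eq0.
Qed.

(** The events of avoiding [A] up to time [k] decrease to an event that is
    incompatible with infinitely many visits. *)
Lemma avoid_cvg0 x (A : set R) : E x -> measurable A -> A `<=` E ->
  0 < psi A -> avoid P A k x @[k --> \oo] --> 0.
Proof.
move=> Ex mA AE pA; have [d [Om [Q [X [hX X0x rec]]]]] := hH Ex.
pose F k := [set w | forall j, (0 < j <= 0 + k)%N -> ~ A (X j w)].
have FE k : Q (F k) = avoid P A k x.
  have F0 := sigma_algebra_setT (natural_filtration_sigma X 0).
  have := avoid_law hP hX k F0 mA; rewrite setTI => <-.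
  exact: (integral_initial X0x (nnmeas_avoid P k mA)).
have mF k : measurable (F k) by exact: measurable_avoid.
have mcap : measurable (\bigcap_k F k) by exact: bigcapT_measurable.
have mlim : measurable (lim_sup_set (fun n => X n @^-1` A)).
  apply: bigcapT_measurable => n; apply: bigcup_measurable => j _.
  exact: measurable_funPTI.
have cap0 : Q (\bigcap_k F k) = 0.
  have C0 : Q (~` lim_sup_set (fun n => X n @^-1` A)) = 0.
    by rewrite probability_setC// rec// subee.
  apply: (subset_measure0 mcap (measurableC mlim) _ C0) => w Fw /(_ 1%N I) [j /= j1 Aj].
  by apply: (Fw j I j _ Aj); rewrite j1 add0n leqnn.
have niF : nonincreasing_seq F.
  move=> k l kl; apply/subsetPset => w Fw j /andP[j0 jk]; apply: Fw.
  by rewrite j0 (leq_trans jk).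
have FE' : (fun k => avoid P A k x) = Q \o F by apply/funext => k; rewrite -FE.
rewrite FE' -cap0; apply: nonincreasing_cvg_mu => //.
exact: le_lt_trans (probability_le1 _ _) (ltry _).
Qed.

Context d (Omega : measurableType d) (Pr : probability Omega R)
  (X : nat -> {RV Pr >-> R}).
Hypotheses (hX : markov_chain E P X).

(** By the Markov property at time [n], the probability of no visit after [n] is at
    most the expectation of [avoid A k (X n)], for every [k]. *)
Lemma visits_infinitely_often (A : set R) : measurable A -> A `<=` E ->
  0 < psi A -> Pr (~` lim_sup_set (fun n => X n @^-1` A)) = 0.
Proof.
move=> mA AE pA.
pose T n := [set w | forall j, (n < j)%N -> ~ A (X j w)].
have mT n : measurable (T n).
  rewrite (_ : T n = \bigcap_(j in [set j | (n < j)%N]) X j @^-1` (~` A)); last first.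
    by apply/seteqP; split.
  apply: bigcap_measurableType => j _.
  by apply: measurable_funPTI; exact: measurableC.
have T0 n : Pr (T n) = 0.
  have F0 := sigma_algebra_setT (natural_filtration_sigma X n).
  have Tk k : Pr (T n) <= \int[Pr]_w avoid P A k (X n w).
    rewrite (avoid_law hP hX k F0 mA) setTI.
    apply: le_measure; rewrite ?inE//; first exact: measurable_avoid.
    by move=> w Tw j /andP[nj _]; exact: Tw.
  have mav k : measurable_fun setT (fun w => avoid P A k (X n w)).
    by apply: measurableT_comp => //; exact: (nnmeas_avoid P k mA).1.
  have [] := @dominated_convergence _ _ _ Pr setT measurableT
    (fun k w => avoid P A k (X n w)) (cst 0) (cst 1) mav (measurable_cst _).
  - by apply: aeW => w _; exact: (avoid_cvg0 (hX.1 n w) mA AE pA).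
  - exact: (finite_measure_integrable_cst Pr 1 measurableT).
  - apply: aeW => w k _; rewrite gee0_abs ?avoid_le1//.
    exact: (nnmeas_avoid P k mA).2.
  move=> _ _.
  rewrite integral0 => cv0; apply/eqP; rewrite eq_le measure_ge0 andbT.
  by apply: cvge_ge cv0; apply: nearW.
have mlim : measurable (lim_sup_set (fun n => X n @^-1` A)).
  apply: bigcapT_measurable => n; apply: bigcup_measurable => j _.
  exact: measurable_funPTI.
have U0 : Pr (\bigcup_n T n) = 0.
  exact: measure0_bigcup.
apply: (subset_measure0 (measurableC mlim) _ _ U0); first exact: bigcupT_measurable.
rewrite /lim_sup_set setC_bigcap => w [n _ nA]; exists n => // j nj Aj.
by apply: nA; exists j => //=; exact: ltnW.
Qed.

Lemma num_visits_cvg_infty (A : set R) (m : nat) : measurable A -> A `<=` E ->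
  0 < psi A ->
  (forall n, measurable [set w | (num_visits A (fun t => X t w) n < m)%N]) /\
  Pr [set w | (num_visits A (fun t => X t w) n < m)%N] @[n --> \oo] --> 0.
Proof.
move=> mA AE pA; pose F n := [set w | (num_visits A (fun t => X t w) n < m)%N].
have mF n : measurable (F n).
  have mN : measurable_fun setT (fun w => \sum_(0 <= t < n.+1) (\1_A (X t w) : R))%R.
    by apply: measurable_sum => t; apply: measurableT_comp => //; exact: measurable_indic.
  have := mN measurableT _ (measurable_itv `]-oo, (m%:R : R)[); rewrite setTI.
  congr measurable; apply/seteqP; split => w; rewrite /F /num_visits /= in_itv/=;
    by rewrite -(ltr_nat R) natr_sum.
have niF : nonincreasing_seq F.
  move=> k l kl; apply/subsetPset => w; apply: leq_ltn_trans.
  rewrite /num_visits (@big_cat_nat _ _ _ k.+1 0 l.+1)//=; exact: leq_addr.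
have mcap : measurable (\bigcap_n F n) by exact: bigcapT_measurable.
have mlim : measurable (lim_sup_set (fun n => X n @^-1` A)).
  apply: bigcapT_measurable => n; apply: bigcup_measurable => j _.
  exact: measurable_funPTI.
have cap0 : Pr (\bigcap_n F n) = 0.
  apply: (subset_measure0 mcap (measurableC mlim) _ (visits_infinitely_often mA AE pA)).
  move=> w Fw lw.
  suff [n mn] : exists n, (m <= num_visits A (fun t => X t w) n)%N.
    by have := Fw n I; rewrite /F/= ltnNge mn.
  elim: (m) => [|k [n kn]]; first by exists 0%N.
  have [j /= nj Aj] := lw n.+1 I; exists j.
  rewrite /num_visits big_nat_recr//= mem_set// addn1 ltnS; apply: (leq_trans kn).
  rewrite /num_visits (@big_cat_nat _ _ _ n.+1 0 j)//=; exact: leq_addr.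
split => //; rewrite -cap0; apply: nonincreasing_cvg_mu => //.
exact: (le_lt_trans (probability_le1 _ (mF 0%N)) (ltry _)).
Qed.

End recurrence.

(** * Invariant measures of Harris recurrent chains *)

Section invariant_measures.
Local Open Scope ereal_scope.
Context (R : realType) (E : set R) (P : R.-pker R ~> R).
Context (psi mu : {measure set R -> \bar R}).
Hypotheses (hP : transition_kernel E P) (hpsi : irreducibility_measure E P psi)
  (hH : harris_recurrent E P psi) (hmu : invariant_measure E P mu).

Let mE : measurable E. Proof. by case: hP. Qed.

Lemma invariant_integral (f : R -> \bar R) : nnmeas f ->
  \int[mu]_x f x = \int[mu]_(x in E) \int[P x]_y f y.
Proof.
have [_ muE _ inv] := hmu.
apply: (integral_like_ext (integral_like_integral mu)
  (integral_like_kernel mu P mE (h := id) _)) => // B mB.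
rewrite integral_indic// setIT.
transitivity (mu (B `&` E)).
  by apply/esym; exact: measure_setI_conull.
rewrite inv; [|exact: measurableI|exact: subIsetr].
apply: eq_integral => x /[!inE] Ex.
by rewrite (kernel_setI hP mB Ex) integral_indic// setIT.
Qed.

Lemma nnmeas_restrict (A : set R) (f : R -> \bar R) : measurable A ->
  nnmeas f -> nnmeas (f \_ A).
Proof.
move=> mA [mf f0]; split; last by move=> x; rewrite /patch; case: ifP.
by apply/(measurable_restrictT _ mA); exact: measurable_funTS.
Qed.

(** Harris recurrence leaves no room for an invariant measure with mass outside
    the part of the space that the chain can see.  Were [A] inaccessible from
    [x0], the states [G] from which it is inaccessible would be absorbing, and a
    positive flow of mass from the complement [H] into [G] would accumulate to
    infinite mass on the recurrent set [C]; without that flow [H] could not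
    reach [G]. *)
Lemma invariant_irreducible (C : set R) : measurable C -> C `<=` E ->
  0 < psi C -> mu C < +oo -> irreducibility_measure E P mu.
Proof.
move=> mC CE pC muC; have [sfmu muE muE0 inv] := hmu.
split => // A mA AE muA x0 Ex0; apply: contrapT => noreach.
pose reach n := [set x | kernel_iter P n x A != 0].
have mreach n : measurable (reach n).
  rewrite -[X in measurable X]setTI; apply: measurable_neqe => //.
  exact: (nnmeas_kernel_iter P n mA).1.
pose H := E `&` \bigcup_n reach n.+1.
pose G := E `&` ~` H.
have mH : measurable H by apply: measurableI => //; exact: bigcupT_measurable.
have mEC : measurable (~` E) by exact: measurableC.
have mG : measurable G by apply: measurableI => //; exact: measurableC.
have HE : H `<=` E by exact: subIsetl.
have GE : G `<=` E by exact: subIsetl.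
have G0 x n : G x -> kernel_iter P n.+1 x A = 0.
  move=> [Ex nH]; apply/eqP; apply: contrapT => /negP h; apply: nH; split => //.
  by exists n.
have Gx0 : G x0.
  split => // -[_ [n _ /= hn]]; apply: noreach; exists n.+1 => //.
  by rewrite lt0e hn /=; exact: (nnmeas_kernel_iter P n.+1 mA).2.
have EGH : E = G `|` H.
  apply/seteqP; split => [x Ex|x [/GE|/HE]//].
  by have [Hx|nHx] := pselect (H x); [right|left].
have GH0 : [disjoint G & H].
  by apply/disj_set2P/seteqP; split => // x [[_ nH] Hx].
(* If [A] is inaccessible from [x], it is inaccessible after one more step. *)
have PGH x : G x -> P x H = 0.
  move=> Gx; apply: (subset_measure0 mH (bigcupT_measurable _ (fun n => mreach n.+1))).
    by move=> y [].
  apply: measure0_bigcup => // n.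
  have := G0 x n.+1 Gx.
  move/(ge0_integral_eq0P (P x) measurableT (nnmeas_kernel_iter P n.+1 mA)).
  by rewrite setTI.
have PnGH n x : G x -> kernel_iter P n x H = 0.
  elim: n x => [|n IH] x Gx /=.
    by rewrite diracE memNset// => Hx; case: Gx => _; apply.
  apply/(ge0_integral_eq0P (P x) measurableT (nnmeas_kernel_iter P n mH)).
  rewrite setTI; apply: (subset_measure0 _ _ _ (measure0_setU mH mEC (PGH x Gx)
    (kernel_setC hP (GE _ Gx)))).
  - by rewrite -[X in measurable X]setTI; apply: measurable_neqe => //;
      exact: (nnmeas_kernel_iter P n mH).1.
  - exact: measurableU.
  - move=> y /= /eqP iy; have [Ey|] := pselect (E y); last by right.
    by rewrite EGH in Ey; case: Ey => [Gy|]; [case: iy; exact: IH|left].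
have psiH : psi H = 0.
  apply: contrapT => /eqP psiH; have [_ _ _ irr] := hpsi.
  have [|n n0] := irr H mH HE _ x0 Ex0; first by rewrite lt0e psiH measure_ge0.
  by rewrite PnGH// ltxx.
have psiG : psi (~` G) = 0.
  have [_ psiE _ _] := hpsi.
  apply: (subset_measure0 _ _ _ (measure0_setU mH mEC psiH psiE)).
  - exact: measurableC.
  - exact: measurableU.
  - move=> x nGx; have [Ex|] := pselect (E x); last by right.
    by rewrite EGH in Ex; case: Ex => // Hx; left.
have psiB : 0 < psi (C `&` G) by rewrite measure_setI_conull.
have muH : mu H != 0.
  apply: contraTneq muA => muH; rewrite -leNgt inv//.
  suff -> : \int[mu]_(x in E) P x A = 0 by [].
  have nnA : nnmeas (fun x => P x A).
    by split; [exact: measurable_kernel|move=> x; exact: measure_ge0].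
  apply/(ge0_integral_eq0P mu mE nnA).
  apply: (subset_measure0 _ mH _ muH).
    by apply: measurable_neqe => //; apply: measurable_funTS; exact: nnA.1.
  move=> x [Ex /= /eqP PA]; rewrite EGH in Ex; case: Ex => // Gx.
  by case: PA; rewrite -kernel_iter1//; exact: G0.
pose B := C `&` G.
have mB : measurable B by exact: measurableI.
have BE : B `<=` E by move=> x [/CE].
pose K (f : R -> \bar R) x := \int[P x]_(y in G) f y.
have nnK f : nnmeas f -> nnmeas (K f).
  move=> nf; rewrite /K; under eq_fun do rewrite integral_mkcond.
  by apply: nnmeas_kernel_integral; exact: nnmeas_restrict.
(* Invariance split according to the current state: what [G] carries after one
   step was carried by [G] or has flowed in from [H]. *)
have flow f : nnmeas f -> \int[mu]_(x in G) f x =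
    \int[mu]_(x in G) \int[P x]_y f y + \int[mu]_(x in H) K f x.
  move=> nf; have nKf := nnK f nf.
  rewrite integral_mkcond invariant_integral; last exact: nnmeas_restrict.
  transitivity (\int[mu]_(x in E) K f x).
    by apply: eq_integral => x _; rewrite /K [RHS]integral_mkcond.
  rewrite {1}EGH ge0_integral_setU//; last 2 first.
    by rewrite -EGH; apply: measurable_funTS; exact: nKf.1.
    by move=> x _; exact: nKf.2.
  congr (_ + _); apply: eq_integral => x /[!inE] Gx.
  have PG0 : P x (~` G) = 0.
    apply: (subset_measure0 _ _ _ (measure0_setU mH mEC (PGH x Gx)
      (kernel_setC hP (GE _ Gx)))).
    - exact: measurableC.
    - exact: measurableU.
    - move=> y nGy; have [Ey|] := pselect (E y); last by right.
      by rewrite EGH in Ey; case: Ey => // Hy; left.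
  rewrite [RHS](@ge0_negligible_integral _ _ _ (P x) setT (~` G))//.
  - by rewrite setTD setCK.
  - exact: measurableC.
  - exact: nf.1.
  - by move=> y _; exact: nf.2.
have flowN N : \int[mu]_(x in G) kernel_iter P N x B +
    \sum_(k < N) \int[mu]_(x in H) K (kernel_iter P k ^~ B) x = mu B.
  elim: N => [|N <-].
    rewrite big_ord0 adde0 /=.
    rewrite (eq_integral (fun x => (\1_B x)%:E)); last first.
      by move=> x _; rewrite diracE indicE.
    by rewrite integral_indic//; congr (mu _); apply/seteqP; split=> [x []|x [? ?]].
  rewrite (flow _ (nnmeas_kernel_iter P N mB)) -addeA big_ord_recr.
  exact: (congr1 (fun z => \int[mu]_(x in G) kernel_iter P N.+1 x B + z)
    (addeC _ _)).
have muB : mu B < +oo.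
  apply: le_lt_trans muC; apply: le_measure; rewrite ?inE//.
  exact: subIsetl.
pose U x := \sum_(n <oo) kernel_iter P n x B.
have U0 n x : 0 <= kernel_iter P n x B by exact: (nnmeas_kernel_iter P n mB).2.
have mU n : measurable_fun setT (fun x => kernel_iter P n x B).
  exact: (nnmeas_kernel_iter P n mB).1.
have nnU : nnmeas U.
  split; last by move=> x; exact: nneseries_ge0.
  by apply: ge0_emeasurable_sum => // n x _ _; exact: U0.
have KU : \int[mu]_(x in H) K U x <= mu B.
  have -> : \int[mu]_(x in H) K U x =
      \sum_(n <oo) \int[mu]_(x in H) K (kernel_iter P n ^~ B) x.
    rewrite -integral_nneseries//; last 2 first.
    - move=> n; apply: measurable_funTS; apply: (nnK _ _).1.
      exact: nnmeas_kernel_iter.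
    - by move=> n x _; apply: integral_ge0.
    apply: eq_integral => x _; rewrite /K /U integral_nneseries//.
    by move=> n; exact: measurable_funTS.
  apply: lime_le.
    apply: is_cvg_nneseries => n _ _; apply: integral_ge0 => x _.
    exact: integral_ge0.
  apply: nearW => n; rewrite big_mkord -(flowN n) leeDr//.
  exact: integral_ge0.
(* The expected number [U] of visits to [B] is infinite on [G], so that mass
   flowing from [H] into [G] would make the integral in [KU] infinite. *)
have N1 : mu (H `&` [set x | P x G != 0]) = 0.
  have := ge0_integral_pinfty mH (nnK _ nnU) (le_lt_trans KU muB).
  apply: subset_measure0.
  - by apply: measurable_neqe => //; apply: measurable_funTS; exact: measurable_kernel.
  - rewrite (_ : [set x | _] = K U @^-1` [set +oo]); last by apply/seteqP; split.
    by apply: (measurable_funTS (nnK _ nnU).1) => //; exact: emeasurable_set1.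
  - move=> x [Hx /= PG]; split => //=.
    rewrite /K (eq_integral (cst +oo)).
      by rewrite integral_cst// gt0_mulye// lt0e PG measure_ge0.
    move=> y /[!inE] Gy; apply: (sum_kernel_iter_pinfty hP hH) => //.
    exact: GE.
have mN n : measurable (H `&` [set x | kernel_iter P n x G != 0]).
  apply: measurable_neqe => //; apply: measurable_funTS.
  exact: (nnmeas_kernel_iter P n mG).1.
have Nn n : mu (H `&` [set x | kernel_iter P n x G != 0]) = 0.
  elim: n => [|n IH].
    rewrite (_ : _ `&` _ = set0) ?measure0//.
    apply/seteqP; split => // x [Hx /=]; rewrite diracE memNset ?eqxx//.
    by case.
  set N := _ `&` _ in IH; have mNn : measurable N by exact: mN.
  have nnN : nnmeas (fun x => P x N).
    by split; [exact: measurable_kernel|move=> x; exact: measure_ge0].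
  have mPN : measurable (E `&` [set x | P x N != 0]).
    by apply: measurable_neqe => //; apply: measurable_funTS; exact: nnN.1.
  have PN0 : mu (E `&` [set x | P x N != 0]) = 0.
    apply/(ge0_integral_eq0P mu mE nnN); rewrite -inv//.
    by move=> x [/HE].
  have mPG : measurable (H `&` [set x | P x G != 0]).
    by apply: measurable_neqe => //; apply: measurable_funTS; exact: measurable_kernel.
  apply: (subset_measure0 (mN _) _ _ (measure0_setU mPG mPN N1 PN0)).
    exact: measurableU.
  move=> x [Hx /= iG].
  have [PG|PG] := eqVneq (P x G) 0; last by left.
  have [PN|PN] := eqVneq (P x N) 0; last by right; split => //; exact: HE.
  exfalso; move: iG => /eqP; apply.
  apply/(ge0_integral_eq0P (P x) measurableT (nnmeas_kernel_iter P n mG)).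
  rewrite setTI; have PGN := measure0_setU mG mNn PG PN.
  apply: (subset_measure0 _ _ _ (measure0_setU (measurableU _ _ mG mNn) mEC PGN
    (kernel_setC hP (HE _ Hx)))).
  - by rewrite -[X in measurable X]setTI; apply: measurable_neqe => //;
      exact: (nnmeas_kernel_iter P n mG).1.
  - by apply: measurableU => //; exact: measurableU.
  - move=> y /= iy; have [Ey|] := pselect (E y); last by right.
    by left; rewrite EGH in Ey; case: Ey => [Gy|Hy]; [left|right].
have psiG0 : 0 < psi G.
  by apply: (lt_le_trans psiB); apply: le_measure; rewrite ?inE//; exact: subIsetr.
move: muH => /eqP; apply.
apply: (subset_measure0 mH _ _ (measure0_bigcup mN Nn)); first exact: bigcupT_measurable.
move=> x Hx; have [_ _ _ irr] := hpsi.
have [n _ iG] := irr G mG GE psiG0 x (HE _ Hx).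
by exists n => //; split => //=; rewrite gt_eqF.
Qed.

End invariant_measures.

(** * Isotonic least squares on a fixed sample *)

Section isotonic_least_squares.
Context (R : realType).
Implicit Types (C : set R) (x z : nat -> R) (g f : R -> R).

Lemma ex_pos_lower_bound (I : eqType) (s : seq I) (h : I -> R) (e : R) : 0 < e ->
  exists2 eta, 0 < eta <= e & forall i, i \in s -> 0 < h i -> eta <= h i.
Proof.
move=> e0; elim: s => [|j s [eta /andP[eta0 etae] IH]].
  by exists e => //; rewrite e0 lexx.
exists (if 0 < h j then Num.min eta (h j) else eta).
  by case: ifPn => [hj|_]; rewrite ?lt_min ?ge_min ?eta0 ?hj ?etae.
move=> i; rewrite inE => /predU1P[->|si] hi; first by rewrite hi ge_min lexx orbT.
by case: ifPn => _; rewrite ?ge_min IH.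
Qed.

(** Lowering a least squares fit by a small constant on the part of a level set
    to the right of [u] keeps it non-increasing, hence cannot decrease the
    residual sum.  To first order in the constant this gives the sign of the sum
    of the residuals over that part. *)
Lemma lse_level_set_sum C x z n g (u a : R) : nonincreasing_fun g ->
  (forall f, nonincreasing_fun f ->
     residual_sum C x z n g <= residual_sum C x z n f) ->
  0 <= \sum_(t < n.+1 | [&& x t \in C, u <= x t & a <= g (x t)]) (z t - g (x t)).
Proof.
move=> gni gopt; set Sum := \sum_(t < _ | _) _.
set N : R := \sum_(t < n.+1 | [&& x t \in C, u <= x t & a <= g (x t)]) 1.
have N0 : 0 <= N by apply: sumr_ge0.
rewrite leNgt; apply/negP => Sneg.
have e0 : 0 < - Sum / (N + 1) by rewrite divr_gt0 ?oppr_gt0// ltr_wpDl.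
(* [eta] must not exceed the gap between [a] and the values of the fit below [a],
   and must be small enough for the first order term to dominate. *)
have [eta /andP[eta0 etae] etah] := @ex_pos_lower_bound _ (enum 'I_n.+1)
  (fun t => a - g (x t)) _ e0.
pose f y := if y < u then g y else
  if a <= g y then g y - eta else Num.min (g y) (a - eta).
have fni : nonincreasing_fun f.
  move=> y1 y2 y12; have g12 := gni _ _ y12; rewrite /f.
  case: (ltP y1 u) => h1; case: (ltP y2 u) => h2.
  - exact: g12.
  - case: ifPn => _; first by lra.
    by rewrite ge_min g12.
  - by have := le_lt_trans y12 h2; rewrite ltNge h1.
  - case: ifPn => a2; case: ifPn => a1.
    + lra.
    + by move: a1; rewrite (le_trans a2 g12).
    + by rewrite ge_min; apply/orP; right; lra.
    + by rewrite le_min !ge_min g12 lexx orbT.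
have := gopt f fni; rewrite /residual_sum !big_mkord.
rewrite -subr_ge0 -sumrB.
rewrite (_ : \sum_(t < _ | _) _ = 2 * eta * Sum + eta ^+ 2 * N).
  rewrite leNgt => /negP; apply.
  have hN : eta * N < - Sum.
    apply: (@le_lt_trans _ _ (- Sum / (N + 1) * N)); first by rewrite ler_wpM2r.
    rewrite mulrAC ltr_pdivrMr ?ltr_wpDl// mulrDr mulr1 ltrDl oppr_gt0//.
  rewrite (_ : _ + _ = eta * (2 * Sum + eta * N)); last by ring.
  by rewrite pmulr_rlt0//; lra.
rewrite /Sum /N !mulr_sumr -big_split/=.
rewrite [RHS]big_mkcond [LHS]big_mkcond/=; apply: eq_bigr => t _.
rewrite /f; case: (boolP (x t \in C)) => //= xC.
case: (ltP (x t) u) => h1 /=; first by rewrite subrr.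
case: ifPn => ha; first by ring.
rewrite min_l ?subrr//.
have := etah t (mem_enum _ _); rewrite subr_gt0 -ltNge in ha *; rewrite ha => /(_ isT).
lra.
Qed.

(** If the fit overshoots at [x1], then averaging over the level set of [g x1]
    shows that the noise has a large mean over a block of sites that starts at
    [u] and contains the sites of [[u, x1]]. *)
Lemma lse_overshoot C x z (W : nat -> R) n g f0 (u x1 eps : R) :
  nonincreasing_fun g ->
  (forall f, nonincreasing_fun f ->
     residual_sum C x z n g <= residual_sum C x z n f) ->
  nonincreasing_fun f0 -> (forall t, z t = f0 (x t) + W t) ->
  f0 u <= f0 x1 + eps / 2 -> f0 x1 + eps < g x1 ->
  exists S : {set 'I_n.+1},
    [/\ forall i : 'I_n.+1, i \in S -> (C `&` [set y | u <= y]) (x i),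
        forall i j : 'I_n.+1, (C `&` [set y | u <= y]) (x i) -> j \in S ->
          x i <= x j -> i \in S,
        (num_visits (C `&` [set y | (u <= y <= x1)%R]) x n <= #|S|)%N &
        eps / 2 * #|S|%:R <= `|\sum_(i in S) W i|].
Proof.
move=> gni gopt f0ni zE f0u gx1.
pose S : {set 'I_n.+1} :=
  [set t : 'I_n.+1 | [&& x t \in C, u <= x t & g x1 <= g (x t)]]%SET.
have SE t : (t \in S) = [&& x t \in C, u <= x t & g x1 <= g (x t)] by rewrite inE.
exists S; split.
- by move=> i; rewrite SE => /and3P[]; rewrite inE.
- move=> i j [Ci ui]; rewrite !SE => /and3P[_ _ gj] ij.
  by rewrite mem_set// [u <= _]ui (le_trans gj)// gni.
- rewrite /num_visits big_mkord -sum1_card.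
  rewrite [leqRHS]big_mkcond; apply: leq_sum => t _.
  case: (boolP (x t \in _)) => //; rewrite inE => -[Ct /= /andP[ut tx1]].
  by rewrite SE mem_set// ut gni.
- rewrite (le_trans _ (ler_norm _))//.
  have := lse_level_set_sum u (g x1) gni gopt; rewrite -/S.
  rewrite -(eq_bigl _ _ SE) => h.
  have -> : \sum_(i in S) W i = \sum_(i in S) (z i - g (x i)) +
      \sum_(i in S) (g (x i) - f0 (x i)).
    by rewrite -big_split/=; apply: eq_bigr => i _; rewrite zE; ring.
  apply: (@le_trans _ _ (\sum_(i in S) (g (x i) - f0 (x i)))); last by rewrite lerDr.
  rewrite mulr_natr -sumr_const; apply: ler_sum => i; rewrite SE => /and3P[_ ui gi].
  have := f0ni _ _ ui; lra.
Qed.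

(** Overshooting for the sample reflected by [y |-> - y] in both coordinates. *)
Lemma lse_undershoot C x z (W : nat -> R) n g f0 (u x1 eps : R) :
  nonincreasing_fun g ->
  (forall f, nonincreasing_fun f ->
     residual_sum C x z n g <= residual_sum C x z n f) ->
  nonincreasing_fun f0 -> (forall t, z t = f0 (x t) + W t) ->
  f0 x1 - eps / 2 <= f0 u -> g x1 < f0 x1 - eps ->
  exists S : {set 'I_n.+1},
    [/\ forall i : 'I_n.+1, i \in S -> (C `&` [set y | y <= u]) (x i),
        forall i j : 'I_n.+1, (C `&` [set y | y <= u]) (x i) -> j \in S ->
          x j <= x i -> i \in S,
        (num_visits (C `&` [set y | (x1 <= y <= u)%R]) x n <= #|S|)%N &
        eps / 2 * #|S|%:R <= `|\sum_(i in S) W i|].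
Proof.
move=> gni gopt f0ni zE f0u gx1.
pose C' := [set y | C (- y)]; pose x' t := - x t.
have refl (h : R -> R) : nonincreasing_fun h -> nonincreasing_fun (fun y => - h (- y)).
  by move=> hni y1 y2 y12 /=; rewrite lerN2; apply: hni; rewrite lerN2.
have resE h : residual_sum C' x' (fun t => - z t) n (fun y => - h (- y)) =
    residual_sum C x z n h.
  rewrite /residual_sum; apply: eq_big => [t|t _]; last first.
    by rewrite /x' (opprK (x t)) -sqrrN; congr (_ ^+ 2); ring.
  by apply/idP/idP; rewrite !inE /C' /x' /= opprK.
have := @lse_overshoot C' x' (fun t => - z t) (fun t => - W t) n
  (fun y => - g (- y)) (fun y => - f0 (- y)) (- u) (- x1) eps.
case.
- exact: refl.
- move=> f fni; rewrite resE (_ : f = fun y => - (- f (- - y))); last first.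
    by apply/funext => y; rewrite !opprK.
  by rewrite (resE (fun y => - f (- y))); apply: gopt; exact: refl.
- exact: refl.
- by move=> t; rewrite zE opprD /x' opprK.
- by rewrite !opprK; lra.
- by rewrite !opprK; lra.
move=> S [S1 S2 S3 S4]; exists S; split.
- by move=> i /S1; rewrite /C' /x' /= opprK lerN2.
- move=> i j [Ci iu] jS ji; apply: (S2 i j) => //; last by rewrite lerN2.
  by rewrite /C' /x' /= opprK lerN2.
- apply: leq_trans S3; rewrite /num_visits; apply: leq_sum => t _.
  case: (boolP (x t \in _)) => //; rewrite inE => -[Ct /= /andP[h1 h2]].
  by rewrite mem_set//; split; rewrite /C' /x' /= ?opprK// !lerN2 h2.
- by rewrite sumrN normrN in S4.
Qed.

Lemma num_visits_gt0 C x n : (0 < num_visits C x n)%N ->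
  exists2 t, (t <= n)%N & C (x t).
Proof.
move=> v0; apply: contrapT => h; move: v0; rewrite /num_visits big_nat big1//.
move=> t /andP[_ tn]; rewrite memNset// => Ct; apply: h; exists t => //.
Qed.

Lemma mem_ordered_points C x n y :
  y \in ordered_points C x n <-> exists2 t, (t <= n)%N & C (x t) /\ y = x t.
Proof.
rewrite /ordered_points mem_sort mem_undup; split => [/mapP[t]|[t tn [Ct ->]]].
  rewrite mem_filter mem_iota/= add0n ltnS => /andP[+ tn] ->; rewrite inE => Ct.
  by exists t.
by apply/mapP; exists t => //; rewrite mem_filter mem_iota/= add0n ltnS tn andbT inE.
Qed.

Lemma ordered_points_bounds C x n y : y \in ordered_points C x n ->
  (ordered_points C x n)`_0 <= y <= last 0 (ordered_points C x n).
Proof.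
have : sorted <=%R (ordered_points C x n).
  by apply: sort_sorted => ? ?; exact: le_total.
case: (ordered_points C x n) => [//|y0 s] /= sorted_s ys.
have h i j : (i <= j < size (y0 :: s))%N -> (y0 :: s)`_i <= (y0 :: s)`_j.
  move=> /andP[ij js]; apply: (sorted_leq_nth le_trans le_refl) => //.
  by rewrite inE (leq_ltn_trans ij).
have lastE : (y0 :: s)`_(size s) = last y0 s := nth_last 0 (y0 :: s).
have iy : (index y (y0 :: s) < size (y0 :: s))%N by rewrite index_mem.
rewrite -lastE -(nth_index 0 ys); apply/andP; split; first exact: (h 0%N _ iy).
by apply: (h _ (size s)); rewrite /= ltnSn andbT -ltnS.
Qed.

Lemma ex_max_seq (s : seq R) : s != [::] ->
  exists2 y, y \in s & forall y', y' \in s -> y' <= y.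
Proof.
elim: s => [//|y s IH] _; have [->|s0] := eqVneq s [::].
  by exists y; [rewrite inE|move=> y'; rewrite inE => /eqP ->].
have [v vs vmax] := IH s0; have [yv|vy] := leP y v.
  exists v; first by rewrite inE vs orbT.
  by move=> y'; rewrite inE => /predU1P[->//|]; exact: vmax.
exists y; first by rewrite inE eqxx.
move=> y'; rewrite inE => /predU1P[->//|/vmax h]; exact: le_trans h (ltW vy).
Qed.

(** Left-continuity of the step function makes the set in the definition of the
    generalized inverse closed on the right, with its maximum at a data point. *)
Lemma generalized_inverse_ge C x z n g (lo a p : R) :
  localized_isotonic_lse C x z n g ->
  (0 < num_visits C x n)%N -> lo < (ordered_points C x n)`_0 ->
  lo <= p <= last 0 (ordered_points C x n) -> a <= g p ->
  let y := generalized_inverse g lo (last 0 (ordered_points C x n)) a in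
  p <= y /\ a <= g y.
Proof.
move=> [gni gopt glo gmid ghi] v0 loY /andP[lop phi] agp /=.
set Y := ordered_points C x n in glo gmid ghi loY phi *.
have lastY : last 0 Y \in Y.
  have [t tn Ct] := num_visits_gt0 v0.
  have last_mem (s : seq R) v : v \in s -> last 0 s \in s.
    by case: s => [//|y0 s] _; exact: (mem_last y0 s).
  by apply: (last_mem _ (x t)); apply/mem_ordered_points; exists t.
have step y : y <= last 0 Y -> exists v, [/\ v \in Y, y <= v & g v = g y].
  move=> yl; have hasY : has (fun v => y <= v) Y by apply/hasP; exists (last 0 Y).
  have := nth_find 0 hasY; have := @before_find _ 0 (fun v => y <= v) Y.
  have := hasY; rewrite has_find; set k := find _ _.
  move=> kY bk yk; exists Y`_k; split=> //; first exact: mem_nth.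
  case: k kY bk yk => [|k] kY bk yk; first by rewrite glo.
  rewrite [RHS](gmid k)// yk andbT ltNge; apply/negP => yk'.
  by have := bk k (ltnSn _); rewrite yk'.
pose S := [set y | lo <= y <= last 0 Y /\ a <= g y].
have [v [vY pv gv]] := step p phi.
have [|y] := @ex_max_seq [seq v <- Y | a <= g v].
  by apply/eqP => /(congr1 (fun s => v \in s)); rewrite mem_filter vY gv agp.
rewrite mem_filter => /andP[agy yY] ymax.
have /andP[Y0y yl] := ordered_points_bounds yY.
have : (S `&` ubound S) !=set0.
  exists y; split; first by split => //; rewrite yl andbT (ltW (lt_le_trans loY _)).
  move=> y' [/andP[_ y'l] agy'].
  have [v' [v'Y y'v' gv']] := step y' y'l.
  by apply: (le_trans y'v'); apply: ymax; rewrite mem_filter v'Y gv' agy'.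
move=> /(xgetPex lo) [[_ h1] h2]; split; last exact: h1.
by apply: h2; split => //; rewrite lop phi.
Qed.

End isotonic_least_squares.

(** * Consistency of the fit at interior points *)

Section negligible_sequences.
Context d (Omega : measurableType d) (R : realType) (Pr : probability Omega R).
Implicit Types B S : nat -> set Omega.

(** Convergence to [0] in outer probability, in a form that is stable under
    unions and subsets without any measurability of [B n]. *)
Definition vanishing B := forall eta : R, 0 < eta -> \forall n \near \oo,
  exists A : set Omega, [/\ measurable A, (Pr A <= eta%:E)%E & B n `<=` A].

Lemma vanishing_sub B B' : (forall n, B n `<=` B' n) -> vanishing B' -> vanishing B.
Proof.
move=> BB' vB' eta /vB'; apply: filterS => n [A [mA PA BA]].
by exists A; split => //; exact: subset_trans (BB' n) BA.
Qed.

Lemma vanishing_setU B B' : vanishing B -> vanishing B' ->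
  vanishing (fun n => B n `|` B' n).
Proof.
move=> vB vB' eta eta0; have e2 : 0 < eta / 2 by rewrite divr_gt0.
have := vB' _ e2; have := vB _ e2; apply: filterS2.
move=> n [A [mA PA BA]] [A' [mA' PA' BA']]; exists (A `|` A'); split.
- exact: measurableU.
- apply: (le_trans (measureU2 _ mA mA')).
  by rewrite (splitr eta) EFinD; exact: leeD.
- exact: setUSS.
Qed.

Lemma vanishing_measurable B : (forall n, measurable (B n)) ->
  Pr (B n) @[n --> \oo] --> 0%E -> vanishing B.
Proof.
move=> mB /fine_cvgP[_ cB] eta eta0.
move: (cB) => /cvgrPdistC_le /(_ _ eta0); apply: filterS => n hn.
exists (B n); split => //; rewrite -(fineK (fin_num_measure Pr _ (mB n))) lee_fin.
by rewrite subr0 in hn; exact: le_trans (ler_norm _) hn.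
Qed.

Lemma vanishing_mu_ext B : vanishing B -> mu_ext Pr (B n) @[n --> \oo] --> 0%E.
Proof.
move=> vB; have le1 eta : 0 < eta -> \forall n \near \oo, (mu_ext Pr (B n) <= eta%:E)%E.
  move=> /vB; apply: filterS => n [A [mA PA BA]].
  by apply: (le_trans (le_mu_ext Pr BA)); rewrite measurable_mu_extE.
have ge0 n : (0 <= mu_ext Pr (B n))%E by exact: mu_ext_ge0.
apply/fine_cvgP; split.
  apply: filterS (le1 1 ltr01) => n h; rewrite ge0_fin_numE//.
  exact: le_lt_trans h (ltry _).
apply/cvgrPdistC_le => eps eps0; apply: filterS (le1 _ eps0) => n h.
have fn : mu_ext Pr (B n) \is a fin_num.
  by rewrite ge0_fin_numE//; exact: le_lt_trans h (ltry _).
rewrite /= subr0 ger0_norm ?fine_ge0//.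
by rewrite -lee_fin fineK.
Qed.

End negligible_sequences.

Section noise.
Context d (Omega : measurableType d) (R : realType) (Pr : probability Omega R).
Context (X W : nat -> {RV Pr >-> R}) (sigma : R).
Hypothesis (hWindep : forall n, cond_independent Pr (natural_filtration X n)
  (fun t : 'I_n.+1 => W t : Omega -> R)).
Hypothesis (hWmean : forall n t, (t <= n)%N ->
  is_cond_exp Pr (natural_filtration X n) (W t) (fun=> 0)).
Hypothesis (hWvar : forall n t, (t <= n)%N ->
  exists2 V : Omega -> R, is_cond_var Pr (natural_filtration X n) (W t) V &
    {ae Pr, forall w, V w <= sigma ^+ 2}).

Let noise_sqr n t : (t <= n)%N ->
  Pr.-integrable setT (EFin \o (fun w => W t w ^+ 2)) /\
  forall D, natural_filtration X n D ->
    (\int[Pr]_(w in D) (W t w ^+ 2)%:E <= (sigma ^+ 2)%:E * Pr D)%E.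
Proof.
move=> tn; have [V VW Vs] := hWvar tn.
exact: (cond_var_bound (natural_filtration_sigma X n)
  (@natural_filtration_measurable _ _ _ _ X n) (hWmean tn) VW Vs).
Qed.

Let noise_mul i j :
  Pr.-integrable setT (EFin \o (fun w => W i w * W j w)).
Proof.
have [ii _] := noise_sqr (leqnn i); have [ij _] := noise_sqr (leqnn j).
apply: le_integrable (integrableD measurableT ii ij) => //.
  by apply/measurable_EFinP; exact: measurable_funM.
move=> w _; rewrite /= lee_fin normrM [leRHS]ger0_norm ?addr_ge0 ?sqr_ge0//.
rewrite -(real_normK (num_real (W i w))) -(real_normK (num_real (W j w))).
have := sqr_ge0 (`|W i w| - `|W j w|).
have := mulr_ge0 (normr_ge0 (W i w)) (normr_ge0 (W j w)); nra.
Qed.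

(** A block that contains the sites of [A] has many sites, and then its mean
    noise is small, uniformly over the blocks. *)
Lemma noise_blocks_vanishing (key : nat -> Omega -> R) (J A : set R) (eps : R) :
  (forall n i B, (i <= n)%N -> measurable B ->
     natural_filtration X n (key i @^-1` B)) ->
  measurable J -> 0 < eps ->
  (forall m, vanishing Pr
     (fun n => [set w | (num_visits A (fun t => X t w) n < m)%N])) ->
  vanishing Pr (fun n => [set w | exists S : {set 'I_n.+1},
    [/\ forall i : 'I_n.+1, i \in S -> J (key i w),
        forall i j : 'I_n.+1, J (key i w) -> j \in S ->
          key i w <= key j w -> i \in S,
        (num_visits A (fun t => X t w) n <= #|S|)%N &
        eps * #|S|%:R <= `|\sum_(i in S) W i w|]]).
Proof.
move=> Gkey mJ eps0 vA eta eta0; have e2 : 0 < eta / 2 by rewrite divr_gt0.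
pose K := 40 * sigma ^+ 2 / eps ^+ 2.
have K0 : 0 <= K by apply: divr_ge0; rewrite ?sqr_ge0// mulr_ge0 ?sqr_ge0.
(* Blocks of at least [m ^ 2] sites have mean noise at least [eps] with
   probability at most [K / m]. *)
pose m := (Num.truncn (K / (eta / 2))).+1.
have mK : K / m%:R <= eta / 2.
  rewrite ler_pdivrMr ?ltr0n// -ler_pdivrMl// mulrC ltW//.
  exact: truncnS_gt.
have := vA (m ^ 2)%N _ e2; apply: filterS => n [V [mV PV hV]].
have [B [mB PB hB]] := @maximal_inequality d Omega R Pr (natural_filtration X n)
  n.+1 (fun i => W i : Omega -> R) (fun i => key i) (sigma ^+ 2) J m eps
  (natural_filtration_sigma X n) (@natural_filtration_measurable _ _ _ _ X n) mJ
  (fun i => measurable_funPT (W i)) (fun i B mB => Gkey n i B (leq_ord i) mB)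
  (fun i j => noise_mul i j)
  (fun i j D ij FD => cond_independent_orthogonal (natural_filtration_sigma X n)
    (@natural_filtration_measurable _ _ _ _ X n) (@hWindep n)
    (fun t => measurable_funPT (W t)) ij (hWmean (leq_ord i)) (noise_mul i j) FD)
  (fun i D FD => (noise_sqr (leq_ord i)).2 D FD) (sqr_ge0 _) isT eps0.
exists (V `|` B); split.
- exact: measurableU.
- apply: (le_trans (measureU2 _ mV mB)).
  rewrite (splitr eta) EFinD; apply: leeD => //; apply: (le_trans PB).
  by rewrite lee_fin invfM mulrA.
- move=> w [S [S1 S2 S3 S4]].
  have [vis|vis] := ltnP (num_visits A (fun t => X t w) n) (m ^ 2)%N.
    by left; exact: hV.
  by right; apply: (hB w S) => //; exact: leq_trans vis S3.
Qed.

Context (Z : nat -> Omega -> R) (f0 : R -> R) (C : set R)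
  (fhat : nat -> Omega -> R -> R).
Hypothesis (hZ : forall t w, Z t w = f0 (X t w) + W t w).
Hypothesis (f0ni : nonincreasing_fun f0) (mC : measurable C).
Hypothesis (hfhat : forall n w, (0 < num_visits C (fun t => X t w) n)%N ->
  localized_isotonic_lse C (fun t => X t w) (fun t => Z t w) n (fhat n w)).

Let visited (A : set R) := forall m, vanishing Pr
  (fun n => [set w | (num_visits A (fun t => X t w) n < m)%N]).

Lemma num_visits_sub (A B : set R) (x : nat -> R) n : A `<=` B ->
  (num_visits A x n <= num_visits B x n)%N.
Proof.
move=> AB; apply: leq_sum => t _; case: (boolP (x t \in A)) => //.
by rewrite inE => /AB ?; rewrite mem_set.
Qed.

Lemma lse_overshoot_vanishing (u x1 eps : R) : 0 < eps ->
  f0 u <= f0 x1 + eps / 2 -> visited (C `&` [set y | u <= y <= x1]) ->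
  vanishing Pr (fun n => [set w | f0 x1 + eps < fhat n w x1]).
Proof.
move=> eps0 hu vis; have e2 : 0 < eps / 2 by rewrite divr_gt0.
have mJ : measurable (C `&` [set y | u <= y]).
  apply: measurableI => //; rewrite (_ : [set y | _] = `[u, +oo[%classic)//.
  by apply/seteqP; split => y; rewrite /= in_itv/= andbT.
apply: vanishing_sub (vanishing_setU (vis 1%N) (noise_blocks_vanishing
  (key := fun t w => X t w) _ mJ e2 vis)); last first.
  by move=> n i B iln mB; exact: natural_filtration_preimage.
move=> n w /= over.
have [v0|v0] := ltnP (num_visits (C `&` [set y | u <= y <= x1]) (fun t => X t w) n) 1.
  by left.
have [|gni gopt _ _ _] := hfhat (n := n) (w := w).
  by apply: leq_trans v0 _; apply: num_visits_sub; exact: subIsetl.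
right; exact: (lse_overshoot gni gopt f0ni (fun t => hZ t w) hu over).
Qed.

Lemma lse_undershoot_vanishing (u x1 eps : R) : 0 < eps ->
  f0 x1 - eps / 2 <= f0 u -> visited (C `&` [set y | x1 <= y <= u]) ->
  vanishing Pr (fun n => [set w | fhat n w x1 < f0 x1 - eps]).
Proof.
move=> eps0 hu vis; have e2 : 0 < eps / 2 by rewrite divr_gt0.
have mN B : measurable B -> measurable [set y : R | B (- y)].
  move=> mB; rewrite -[X in measurable X]setTI.
  by apply: (oppr_measurable measurableT).
have mJ : measurable [set y | (C `&` [set y | y <= u]) (- y)].
  apply: mN; apply: measurableI => //; rewrite (_ : [set y | _] = `]-oo, u]%classic)//.
apply: vanishing_sub (vanishing_setU (vis 1%N) (noise_blocks_vanishing
  (key := fun t w => - X t w) _ mJ e2 vis)); last first.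
  move=> n i B iln mB; 
  exact: (@natural_filtration_preimage _ _ _ _ X n i [set y | B (- y)] iln (mN _ mB)).
move=> n w /= under.
have [v0|v0] := ltnP (num_visits (C `&` [set y | x1 <= y <= u]) (fun t => X t w) n) 1.
  by left.
have [|gni gopt _ _ _] := hfhat (n := n) (w := w).
  by apply: leq_trans v0 _; apply: num_visits_sub; exact: subIsetl.
have [S [S1 S2 S3 S4]] := lse_undershoot gni gopt f0ni (fun t => hZ t w) hu under.
right; exists S; split => //.
- by move=> i /S1; rewrite opprK.
- by move=> i j; rewrite opprK lerN2 => Ci jS; exact: S2 Ci jS.
Qed.

(** An overshoot at [x1] is excluded by the sites in a left neighbourhood on which
    [f0] stays close to [f0 x1], an undershoot by those in a right one. *)
Lemma lse_consistent (x1 : R) :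
  (forall e, 0 < e -> exists2 u, f0 u <= f0 x1 + e &
     visited (C `&` [set y | u <= y <= x1])) ->
  (forall e, 0 < e -> exists2 u, f0 x1 - e <= f0 u &
     visited (C `&` [set y | x1 <= y <= u])) ->
  forall eps, 0 < eps ->
    vanishing Pr (fun n => [set w | eps < `|fhat n w x1 - f0 x1|]).
Proof.
move=> hl hr eps eps0; have e2 : 0 < eps / 2 by rewrite divr_gt0.
have [u hu visu] := hl _ e2; have [v hv visv] := hr _ e2.
apply: vanishing_sub (vanishing_setU (lse_overshoot_vanishing eps0 hu visu)
  (lse_undershoot_vanishing eps0 hv visv)) => n w /=.
by rewrite lter_normr => /orP[h|h]; [left|right]; lra.
Qed.

End noise.

(** * The main result *)

(** A set [C] of infinite measure would make the localized distribution function
    constant, because [fine] sends [+oo] to [0]. *)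
Lemma localized_cdf_lt_measure (R : realType) (mu : {measure set R -> \bar R})
    (C : set R) (x y : R) : measurable C ->
  localized_cdf mu C x < localized_cdf mu C y ->
  (mu C < +oo)%E /\ (0 < mu (C `&` `]x, y]))%E.
Proof.
move=> mC Fxy.
have muC : (mu C < +oo)%E.
  rewrite ltNge leye_eq; apply/negP => /eqP Coo.
  by move: Fxy; rewrite /localized_cdf Coo /= invr0 !mulr0 ltxx.
split => //; rewrite lt0e measure_ge0 andbT; apply/eqP => A0.
move: Fxy; rewrite /localized_cdf; apply/negP; rewrite -leNgt.
apply: ler_wpM2r; first by rewrite invr_ge0 fine_ge0.
have mI z : measurable (C `&` `]-oo, z]) by exact: measurableI.
have fI z : mu (C `&` `]-oo, z]) \is a fin_num.
  rewrite ge0_fin_numE//; apply: le_lt_trans muC.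
  by apply: le_measure; rewrite ?inE//; exact: subIsetl.
have mA : measurable (C `&` `]x, y]) by exact: measurableI.
apply: fine_le => //.
apply: (@le_trans _ _ (mu ((C `&` `]-oo, x]) `|` (C `&` `]x, y])))).
  apply: le_measure; rewrite ?inE//; first exact: measurableU.
  move=> z [Cz]; rewrite /= !in_itv/= => zy.
  by have [zx|xz] := leP z x; [left|right]; split => //=; rewrite in_itv/= ?xz.
rewrite -[leRHS]adde0 -A0; exact: measureU2.
Qed.

Lemma within_continuous_dist (R : realType) (a b : R) (f : R -> R) x e :
  {within `[a, b], continuous f} -> a < x < b -> 0 < e ->
  exists2 r, 0 < r & forall y, `|x - y| < r -> `|f x - f y| <= e.
Proof.
move=> cf axb e0; have ab : a < b by case/andP: axb; exact: lt_trans.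
have /cvgrPdist_le/(_ _ e0) := within_continuous_continuous ab cf axb.
by move=> /nbhs_ballP[r /= r0 h]; exists r => // y xy; exact: h.
Qed.

Theorem theorem3p1 (R : realType) (d : measure_display)
  (Omega : measurableType d) (Pr : probability Omega R)
  (X : nat -> {RV Pr >-> R}) (W : nat -> {RV Pr >-> R})
  (Z : nat -> Omega -> R) (f0 : R -> R) (x0 : R)
  (hZ : forall t w, Z t w = f0 (X t w) + W t w)
  (E : set R) (P : R.-pker R ~> R)
  (hP : transition_kernel E P)
  (hX : markov_chain E P X)
  (psi : {measure set R -> \bar R})
  (hpsi : maximal_irreducibility_measure E P psi)
  (hHarris : harris_recurrent E P psi)
  (mu : {measure set R -> \bar R})
  (hmu : invariant_measure E P mu)
  (s : R -> R) (nu : probability R R)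
  (hminor : minorization E P s nu)
  (sigma : R) (sigma_gt0 : 0 < sigma)
  (hWindep : forall n, cond_independent Pr (natural_filtration X n)
                         (fun t : 'I_n.+1 => W t : Omega -> R))
  (hWmean : forall n t, (t <= n)%N ->
     is_cond_exp Pr (natural_filtration X n) (W t) (fun=> 0))
  (hWvar : forall n t, (t <= n)%N ->
     exists2 V : Omega -> R,
       is_cond_var Pr (natural_filtration X n) (W t) V &
       {ae Pr, forall w, V w <= sigma ^+ 2})
  (delta : R) (delta_gt0 : 0 < delta)
  (C : set R) (hC : C = `[x0 - delta, x0 + delta]%classic)
  (hsmall : small_set E P psi C)
  (hsupp : interior (measure_support mu) x0)
  (F : R -> R) (hF : F = localized_cdf mu C)
  (hFcont : {within C, continuous F})
  (hFincr : forall x y, C x -> C y -> x < y -> F x < F y)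
  (hFinv : forall x' eps, C x' -> 0 < eps ->
     exists2 gamma : R, 0 < gamma &
       forall u, (F @` C) u -> eps <= `|u - F x'| ->
         gamma < `|pinv C F u - x'|)
  (hf0 : nonincreasing_fun f0)
  (hf0_sep : forall x' eps, C x' -> 0 < eps ->
     exists2 gamma : R, 0 < gamma &
       forall y, eps <= `|y - x'| -> gamma < `|f0 x' - f0 y|)
  (hf0_cont : {within C, continuous f0})
  (fhat : nat -> Omega -> R -> R)
  (hfhat : forall n w, (0 < num_visits C (fun t => X t w) n)%N ->
     localized_isotonic_lse C (fun t => X t w) (fun t => Z t w) n (fhat n w))
  (Y0 : nat -> {RV Pr >-> R})
  (hY0 : forall n w, (0 < num_visits C (fun t => X t w) n)%N ->
     Y0 n w < (ordered_points C (fun t => X t w) n)`_0) :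
  is_oP1 Pr (fun n w => fhat n w x0 - f0 x0) /\
  is_oP1 Pr (fun n w =>
    generalized_inverse (fhat n w) (Y0 n w)
      (last 0 (ordered_points C (fun t => X t w) n)) (f0 x0) - x0).
Proof.
have [psi_irr psi_max] := hpsi.
have [mC CE pC _] := hsmall.
have Cab y : C y <-> x0 - delta <= y <= x0 + delta.
  by rewrite hC /= in_itv.
have F_lt x y : C x -> C y -> x < y ->
    (mu C < +oo)%E /\ (0 < mu (C `&` `]x, y]))%E.
  move=> Cx Cy xy; apply: localized_cdf_lt_measure => //.
  by rewrite -hF; exact: hFincr.
have muC : (mu C < +oo)%E.
  by apply: (F_lt x0 (x0 + delta) _ _ _).1; rewrite ?Cab; lra.
have mu_irr := invariant_irreducible hP psi_irr hHarris hmu mC CE pC muC.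
have /null_content_dominatesP mu_psi := psi_max mu mu_irr.
pose visited (A : set R) := forall m, vanishing Pr
  (fun n => [set w | (num_visits A (fun t => X t w) n < m)%N]).
have vis x y (A : set R) : C x -> C y -> x < y -> C `&` `]x, y] `<=` A -> visited A.
  move=> Cx Cy xy sA m; have [_ muA] := F_lt x y Cx Cy xy.
  have mI : measurable (C `&` `]x, y]) by exact: measurableI.
  have psiA : (0 < psi (C `&` `]x, y]))%E.
    rewrite lt0e measure_ge0 andbT; apply/eqP => /(mu_psi _ mI) mu0.
    by move: muA; rewrite mu0 ltxx.
  have [mV cV] := num_visits_cvg_infty hP hHarris hX m mI
    (subset_trans (@subIsetl _ _ _) CE) psiA.
  apply: vanishing_sub (vanishing_measurable mV cV) => n w /=.
  by apply: leq_ltn_trans; exact: num_visits_sub.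
have consistent x1 : x0 - delta < x1 < x0 + delta -> forall eps, 0 < eps ->
    vanishing Pr (fun n => [set w | eps < `|fhat n w x1 - f0 x1|]).
  move=> /[dup] x1C /andP[lx1 x1r].
  rewrite hC in hf0_cont.
  apply: (lse_consistent hWindep hWmean hWvar hZ hf0 mC hfhat) => e e0.
    have [r r0 hr] := within_continuous_dist hf0_cont x1C e0.
    pose u := x1 - Num.min r (x1 - (x0 - delta)) / 2.
    have um : 0 < Num.min r (x1 - (x0 - delta)) by rewrite lt_min r0; lra.
    have ur : Num.min r (x1 - (x0 - delta)) <= r by rewrite ge_min lexx.
    have ud : Num.min r (x1 - (x0 - delta)) <= x1 - (x0 - delta).
      by rewrite ge_min lexx orbT.
    have ux : u < x1 by rewrite /u; lra.
    exists u.
      have /hr : `|x1 - u| < r by rewrite ger0_norm /u; lra.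
      by rewrite ler_norml => /andP[]; lra.
    apply: (vis u x1) => //; rewrite ?Cab; [rewrite /u; lra|lra|].
    by move=> y [Cy]; rewrite /= in_itv/= => /andP[/ltW -> ->].
  have [r r0 hr] := within_continuous_dist hf0_cont x1C e0.
  pose u := x1 + Num.min r ((x0 + delta) - x1) / 2.
  have um : 0 < Num.min r ((x0 + delta) - x1) by rewrite lt_min r0; lra.
  have ur : Num.min r ((x0 + delta) - x1) <= r by rewrite ge_min lexx.
  have ud : Num.min r ((x0 + delta) - x1) <= (x0 + delta) - x1.
    by rewrite ge_min lexx orbT.
  have ux : x1 < u by rewrite /u; lra.
  exists u.
    have /hr : `|x1 - u| < r by rewrite ler0_norm /u; lra.
    by rewrite ler_norml => /andP[]; lra.
  apply: (vis x1 u) => //; rewrite ?Cab; [lra|rewrite /u; lra|].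
  by move=> y [Cy]; rewrite /= in_itv/= => /andP[/ltW -> ->].
split.
  by move=> eps eps0; apply: vanishing_mu_ext; apply: consistent => //; lra.
move=> eps eps0; apply: vanishing_mu_ext.
(* With high probability the fit at [p] and [q] is within [gamma] of [f0], hence
   crosses the level [f0 x0] between them, and data on both sides of [p] place
   [p] in the range of the generalized inverse. *)
pose e := Num.min eps (delta / 2).
have e0 : 0 < e by rewrite lt_min eps0; lra.
have eeps : e <= eps by rewrite ge_min lexx.
have ed : e <= delta / 2 by rewrite ge_min lexx orbT.
have [gamma gamma0 hgamma] : exists2 gamma : R, 0 < gamma &
    forall y, e <= `|y - x0| -> gamma < `|f0 x0 - f0 y|.
  by apply: hf0_sep => //; rewrite Cab; lra.
pose p := x0 - e; pose q := x0 + e.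
have fp : f0 x0 + gamma < f0 p.
  have /hgamma : e <= `|p - x0| by rewrite ler0_norm /p; lra.
  by have := hf0 p x0 ltac:(rewrite /p; lra) => h; rewrite ler0_norm; lra.
have fq : f0 q < f0 x0 - gamma.
  have /hgamma : e <= `|q - x0| by rewrite ger0_norm /q; lra.
  by have := hf0 x0 q ltac:(rewrite /q; lra) => h; rewrite ger0_norm; lra.
have hp := consistent p ltac:(rewrite /p; lra) gamma gamma0.
have hq := consistent q ltac:(rewrite /q; lra) gamma gamma0.
have vl : visited (C `&` `]-oo, p]).
  apply: (vis (x0 - delta) p); rewrite ?Cab /p; [lra|lra|lra|].
  by move=> y [Cy]; rewrite /= !in_itv/= => /andP[_ ->].
have vr : visited (C `&` `[p, +oo[).
  apply: (vis p x0); rewrite ?Cab /p; [lra|lra|lra|].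
  by move=> y [Cy]; rewrite /= !in_itv/= => /andP[/ltW -> _].
apply: vanishing_sub (vanishing_setU (vanishing_setU (vl 1%N) (vr 1%N))
  (vanishing_setU hp hq)) => n w /= far; apply: contrapT => good.
have [] : ((0 < num_visits (C `&` `]-oo, p]) (fun t => X t w) n)%N /\
    (0 < num_visits (C `&` `[p, +oo[) (fun t => X t w) n)%N) /\
    (`|fhat n w p - f0 p| <= gamma /\ `|fhat n w q - f0 q| <= gamma).
  split; split.
  - by rewrite ltnNge; apply/negP => h; apply: good; left; left; rewrite ltnS.
  - by rewrite ltnNge; apply/negP => h; apply: good; left; right; rewrite ltnS.
  - by rewrite leNgt; apply/negP => h; apply: good; right; left.
  - by rewrite leNgt; apply/negP => h; apply: good; right; right.
move=> [nl nr] [gp gq].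
have v0 : (0 < num_visits C (fun t => X t w) n)%N.
  by apply: leq_trans nl _; apply: num_visits_sub; exact: subIsetl.
have lse := hfhat n w v0; have Ylo := hY0 n w v0.
have [tl tln [Cl pl]] := num_visits_gt0 nl.
have [tr trn [Cr pr]] := num_visits_gt0 nr.
rewrite /= !in_itv/= andbT in pl pr.
have Yl : X tl w \in ordered_points C (fun t => X t w) n.
  by apply/mem_ordered_points; exists tl.
have Yr : X tr w \in ordered_points C (fun t => X t w) n.
  by apply/mem_ordered_points; exists tr.
have /andP[Yl0 _] := ordered_points_bounds Yl.
have /andP[_ Yr1] := ordered_points_bounds Yr.
have [|//|] := generalized_inverse_ge (p := p) (a := f0 x0) lse v0 Ylo.
- by rewrite (le_trans pr Yr1) andbT (le_trans (ltW Ylo) (le_trans Yl0 pl)).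
- by move: gp; rewrite ler_norml => /andP[]; lra.
set y := generalized_inverse _ _ _ _ in far *; move=> py ay.
have [gni _ _ _ _] := lse.
have yq : y < q.
  rewrite ltNge; apply/negP => qy; have := gni _ _ qy.
  by move: gq; rewrite ler_norml => /andP[]; lra.
move: far; apply/negP; rewrite -leNgt ler_norml.
by rewrite /p in py; rewrite /q in yq; apply/andP; split; lra.
Qed.
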